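(* Equip the graph $G$ with the dualistic structure $(g,\nabla,\nabla^* )$ induced by the $c$-divergence $\mathbf D$. Let $\gamma(s)=(p(s),f(p(s)))$ be a primal geodesic (a geodesic of $\nabla$) and $\sigma(t)=(f^{-1}(q'(t)),q'(t))$ be a dual geodesic (a geodesic of $\nabla^*$) in $G$ with $\gamma(0)=\sigma(0)=x$. Let $$X=\dot p(0)\oplus 0,\qquad Y=0\oplus\dot q'(0)\ \in T_x(M\times M').$$ Then $$\frac{\partial^4}{\partial s^2\partial t^2}\mathbf D[\gamma(s):\sigma(t)]\Big|_{s=t=0}=\frac{\partial^4}{\partial s^2\partial t^2}c(p(s),q'(t))\Big|_{s=t=0}=-2\,\overline{\sec}_u(X,Y).$$
   Context: Setting. $M,M'$ are $n$-dimensional smooth manifolds ($n\ge 2$), and $c:M\times M'\to\mathbb R$ is a smooth cost function. In local coordinates $\xi=(\xi^1,\dots,\xi^n)$ on $M$ and $\eta'=(\eta'^{\bar 1},\dots,\eta'^{\bar n})$ on $M'$ write $c_{i:\bar j}=\frac{\partial^2 c}{\partial\xi^i\partial\eta'^{\bar j}}$. The cost is assumed non-degenerate: the matrix $(c_{i:\bar j})$ is invertible at every point. Einstein summation is used. Optimal transport map. $\varphi:M\to\mathbb R$ is smooth and $c$-concave, i.e. there is $\psi:M'\to\mathbb R\cup\{-\infty\}$ with $\varphi(p)=\inf_{q'\in M'}(c(p,q')-\psi(q'))$ for all $p\in M$. For each $p\in M$ there is a unique $q'=:D^c\varphi(p)\in M'$ with $\varphi(p)+\psi(q')=c(p,q')$,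 and $f=D^c\varphi$ is a smooth diffeomorphism from $M$ onto its range $f(M)\subset M'$. $\psi$ is the $c$-transform of $\varphi$: $\psi(q)=\inf_{p\in M}(c(p,q)-\varphi(p))$, so $\psi(q)=c(f^{-1}(q),q)-\varphi(f^{-1}(q))$ for $q\in f(M)$. The graph $G=\{(p,f(p)):p\in M\}$ is an $n$-dimensional embedded submanifold of $M\times M'$. $c$-divergence and dualistic structure. For $x=(p,q),\,x'=(p',q')\in G$, $\mathbf D[x:x']=c(p,q')-\varphi(p)-\psi(q')$. Using coordinates $\xi$ on $G$ via $(p,f(p))\mapsto p$ and writing $\mathbf D=\mathbf D[\xi:\xi']$, define $g_{ij}(\xi)=-\frac{\partial}{\partial\xi^i}\frac{\partial}{\partial\xi'^j}\mathbf D\big|_{\xi'=\xi}$ (a Riemannian metric on $G$), $\Gamma_{ijk}(\xi)=-\frac{\partial^2}{\partial\xi^i\partial\xi^j}\frac{\partial}{\partial\xi'^k}\mathbf D\big|_{\xi'=\xi}$, $\Gamma^*_{ijk}(\xi)=-\frac{\partial^2}{\partial\xi'^i\partial\xi'^j}\frac{\partial}{\partial\xi^k}\mathbf D\big|_{\xi'=\xi}$. The torsion-free connections $\nabla,\nabla^*$ on $G$ have Christoffel symbols $\Gamma_{ij}{}^k=\Gamma_{ijm}g^{mk}$ and $\Gamma^*_{ij}{}^k=\Gamma^*_{ijm}g^{mk}$, with $\nabla_{\partial_i}\partial_j=\Gamma_{ij}{}^k\partial_k$ (similarly for $\nabla^*$). Pseudo-Riemannian metric $h$ on $M\times M'$.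 For $v=a^i\frac{\partial}{\partial\xi^i}+b^{\bar i}\frac{\partial}{\partial\eta'^{\bar i}}$ at $(\xi,\eta')$, $h(v,v)=-c_{i:\bar j}(\xi,\eta')a^ib^{\bar j}$, extended by polarization. $\bar\nabla$ is the Levi-Civita connection of $h$, with curvature $\bar R(X,Y)Z=\bar\nabla_X\bar\nabla_YZ-\bar\nabla_Y\bar\nabla_XZ-\bar\nabla_{[X,Y]}Z$, and $\overline{\sec}_u(X,Y)=h(\bar R(X,Y)Y,X)$. Direct sums refer to the decomposition $T_{(p,q')}(M\times M')=T_pM\oplus T_{q'}M'$. *)

(* Defs.v *)
From HB Require Import structures.
From mathcomp Require Import all_boot all_order all_algebra.
From mathcomp Require Import all_classical all_reals all_analysis.
Set Implicit Arguments.
Unset Strict Implicit.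
Unset Printing Implicit Defensive.
Import Order.TTheory GRing.Theory Num.Theory.
Import numFieldNormedType.Exports.
Local Open Scope classical_set_scope.
Local Open Scope ring_scope.

(* Only used for finite-dimensional V and open U, where quantifying over all
   directions v is the same as quantifying over the coordinate directions. *)
Fixpoint Ck_on (R : realType) (V W : normedModType R) (k : nat) (U : set V)
    (f : V -> W) : Prop :=
  (forall x, U x -> {for x, continuous f}) /\
  match k with
  | 0%N => True
  | k'.+1 => forall v : V,
      (forall x, U x -> derivable f x v) /\ Ck_on k' U ('D_v f)
  end.

Definition smooth_on (R : realType) (V W : normedModType R) (U : set V)
    (f : V -> W) : Prop :=
  forall k, Ck_on k U f.

(* The total functions coords and param are only meaningful on chart_dom and
   chart_cod respectively. *)
Record chart (R : realType) (n : nat) (T : topologicalType) := Chart {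
  chart_dom : set T;
  chart_cod : set 'rV[R]_n;
  coords : T -> 'rV[R]_n;
  param : 'rV[R]_n -> T;
  dom_open : open chart_dom;
  cod_open : open chart_cod;
  coord_cod : forall p, chart_dom p -> chart_cod (coords p);
  param_dom : forall x, chart_cod x -> chart_dom (param x);
  coordK : forall p, chart_dom p -> param (coords p) = p;
  paramK : forall x, chart_cod x -> coords (param x) = x;
  coord_continuous : forall p, chart_dom p -> {for p, continuous coords};
  param_continuous : forall x, chart_cod x -> {for x, continuous param} }.

Record manifold (R : realType) (n : nat) := Manifold {
  space :> topologicalType;
  manifold_hausdorff : hausdorff_space space;
  manifold_second_countable : @second_countable space;
  atlas : set (chart R n space);
  atlas_cover : forall p : space, exists2 chi, atlas chi & chart_dom chi p;
  atlas_smooth : forall chi chi', atlas chi -> atlas chi' ->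
    smooth_on (chart_cod chi `&` param chi @^-1` chart_dom chi')
      (coords chi' \o param chi) }.

Section SmoothMaps.
Variables (R : realType) (n : nat).
Implicit Types M N : manifold R n.

Definition smooth_fun M (phi : M -> R) : Prop :=
  forall chi, atlas chi -> smooth_on (chart_cod chi) (phi \o param chi).

Definition smooth_map_on M N (U : set M) (f : M -> N) : Prop :=
  (forall p, U p -> {for p, continuous f}) /\
  forall chi chi', atlas chi -> atlas chi' ->
    smooth_on (chart_cod chi `&` param chi @^-1` (U `&` f @^-1` chart_dom chi'))
      (coords chi' \o f \o param chi).

Definition smooth_curve M (I : set R) (p : R -> M) : Prop :=
  (forall s, I s -> {for s, continuous p}) /\
  forall chi, atlas chi -> smooth_on (I `&` p @^-1` chart_dom chi) (coords chi \o p).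

Definition diffeo_onto_range M N (f : M -> N) : Prop :=
  smooth_map_on [set: M] f /\ open (range f) /\
  exists2 g : N -> M, cancel f g & smooth_map_on (range f) g.

End SmoothMaps.

Section PartialDerivatives.
Variables (R : realType) (n : nat).
Implicit Type F : 'rV[R]_n * 'rV[R]_n -> R.

Definition partial1 (i : 'I_n) F : 'rV[R]_n * 'rV[R]_n -> R :=
  'D_(delta_mx 0 i, 0) F.

Definition partial2 (i : 'I_n) F : 'rV[R]_n * 'rV[R]_n -> R :=
  'D_(0, delta_mx 0 i) F.

End PartialDerivatives.

Section Cost.
Variables (R : realType) (n : nat) (M M' : manifold R n) (c : M -> M' -> R).

Definition local_cost (chi : chart R n M) (chi' : chart R n M')
    (z : 'rV[R]_n * 'rV[R]_n) : R :=
  c (param chi z.1) (param chi' z.2).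

Definition smooth_cost : Prop :=
  forall chi chi', atlas chi -> atlas chi' ->
    smooth_on (chart_cod chi `*` chart_cod chi') (local_cost chi chi').

Definition cost_mx (chi : chart R n M) (chi' : chart R n M')
    (z : 'rV[R]_n * 'rV[R]_n) : 'M[R]_n :=
  \matrix_(i, j) partial1 i (partial2 j (local_cost chi chi')) z.

Definition nondegenerate_cost : Prop :=
  forall chi chi', atlas chi -> atlas chi' ->
    forall z, (chart_cod chi `*` chart_cod chi') z -> cost_mx chi chi' z \in unitmx.

Definition c_concave (phi : M -> R) : Prop :=
  exists2 psi : M' -> \bar R, (forall q, psi q != +oo%E) &
    forall p, (phi p)%:E = ereal_inf [set ((c p q)%:E - psi q)%E | q in setT].

Definition c_transform (phi : M -> R) (q : M') : \bar R :=
  ereal_inf [set (c p q - phi p)%:E | p in setT].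

Definition is_c_gradient (phi : M -> R) (f : M -> M') : Prop :=
  forall p q,
    ((phi p)%:E + c_transform phi q = (c p q)%:E)%E <-> q = f p.

End Cost.

Section DualisticStructure.
Variables (R : realType) (n : nat) (M M' : manifold R n).
Variables (c : M -> M' -> R) (phi : M -> R) (f : M -> M').

Definition graph : set (M * M') := [set (p, f p) | p in setT].

(* On the graph the c-transform is finite, so fine loses nothing there. *)
Definition c_divergence (x x' : M * M') : R :=
  c x.1 x'.2 - phi x.1 - fine (c_transform c phi x'.2).

(* Coordinates on the graph are those of the first component. *)
Definition local_divergence (chi : chart R n M) (z : 'rV[R]_n * 'rV[R]_n) : R :=
  c_divergence (param chi z.1, f (param chi z.1))
               (param chi z.2, f (param chi z.2)).

Definition metric_g (chi : chart R n M) (x : 'rV[R]_n) : 'M[R]_n :=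
  \matrix_(i, j) - partial1 i (partial2 j (local_divergence chi)) (x, x).

Definition Gamma_low (chi : chart R n M) (x : 'rV[R]_n) (i j k : 'I_n) : R :=
  - partial1 i (partial1 j (partial2 k (local_divergence chi))) (x, x).

Definition Gamma_star_low (chi : chart R n M) (x : 'rV[R]_n)
    (i j k : 'I_n) : R :=
  - partial2 i (partial2 j (partial1 k (local_divergence chi))) (x, x).

Definition christoffel (chi : chart R n M) (x : 'rV[R]_n) (i j k : 'I_n) : R :=
  \sum_m Gamma_low chi x i j m * invmx (metric_g chi x) m k.

Definition christoffel_star (chi : chart R n M) (x : 'rV[R]_n)
    (i j k : 'I_n) : R :=
  \sum_m Gamma_star_low chi x i j m * invmx (metric_g chi x) m k.

Definition graph_geodesic
    (Gamma : chart R n M -> 'rV[R]_n -> 'I_n -> 'I_n -> 'I_n -> R)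
    (I : set R) (gamma : R -> M * M') : Prop :=
  [/\ forall s, I s -> graph (gamma s),
      smooth_curve I (fun s => (gamma s).1) &
      forall chi, atlas chi ->
        forall s, I s -> chart_dom chi (gamma s).1 ->
        let u (i : 'I_n) (r : R) : R := coords chi (gamma r).1 0 i in
        forall k : 'I_n,
          derive1n 2 (u k) s +
          \sum_i \sum_j Gamma chi (coords chi (gamma s).1) i j k *
            derive1 (u i) s * derive1 (u j) s = 0].

Definition primal_geodesic := graph_geodesic christoffel.
Definition dual_geodesic := graph_geodesic christoffel_star.

End DualisticStructure.

(* Vector fields on an open set U of a normed space V are total functions
   V -> V of which only the values on U matter; a tangent vector of a product
   chart is the pair of its components in the two factors. *)
Section LeviCivita.
Variables (R : realType) (V : normedModType R).
Implicit Types (U : set V) (X Y Z : V -> V) (a : V -> R).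

Definition lie_bracket X Y (z : V) : V := 'D_(X z) Y z - 'D_(Y z) X z.

Record is_connection U (nabla : (V -> V) -> (V -> V) -> V -> V) : Prop := {
  connection_ext : forall X X' Y Y',
    (forall z, U z -> X z = X' z) -> (forall z, U z -> Y z = Y' z) ->
    forall z, U z -> nabla X Y z = nabla X' Y' z;
  connection_smooth : forall X Y, smooth_on U X -> smooth_on U Y ->
    smooth_on U (nabla X Y);
  connection_linear : forall a X X' Y,
    smooth_on U a -> smooth_on U X -> smooth_on U X' -> smooth_on U Y ->
    forall z, U z ->
      nabla (fun w => a w *: X w + X' w) Y z =
      a z *: nabla X Y z + nabla X' Y z;
  connection_leibniz : forall a X Y Y',
    smooth_on U a -> smooth_on U X -> smooth_on U Y -> smooth_on U Y' ->
    forall z, U z ->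
      nabla X (fun w => a w *: Y w + Y' w) z =
      'D_(X z) a z *: Y z + a z *: nabla X Y z + nabla X Y' z }.

Record is_levi_civita U (h : V -> V -> V -> R)
    (nabla : (V -> V) -> (V -> V) -> V -> V) : Prop := {
  levi_civita_connection : is_connection U nabla;
  levi_civita_torsion_free : forall X Y, smooth_on U X -> smooth_on U Y ->
    forall z, U z -> nabla X Y z - nabla Y X z = lie_bracket X Y z;
  levi_civita_metric : forall X Y Z,
    smooth_on U X -> smooth_on U Y -> smooth_on U Z ->
    forall z, U z ->
      'D_(X z) (fun w => h w (Y w) (Z w)) z =
      h z (nabla X Y z) (Z z) + h z (Y z) (nabla X Z z) }.

Definition curvature (nabla : (V -> V) -> (V -> V) -> V -> V) X Y Z (z : V) : V :=
  nabla X (nabla Y Z) z - nabla Y (nabla X Z) z - nabla (lie_bracket X Y) Z z.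

(* Unnormalized: not divided by the area of the plane spanned by X and Y. *)
Definition sec_u (h : V -> V -> V -> R)
    (nabla : (V -> V) -> (V -> V) -> V -> V) X Y (z : V) : R :=
  h z (curvature nabla X Y Y z) (X z).

End LeviCivita.

Section PseudoRiemannianMetric.
Variables (R : realType) (n : nat) (M M' : manifold R n) (c : M -> M' -> R).
Variables (chi : chart R n M) (chi' : chart R n M').

Definition quad_h (z v : 'rV[R]_n * 'rV[R]_n) : R :=
  - \sum_i \sum_j cost_mx c chi chi' z i j * v.1 0 i * v.2 0 j.

Definition metric_h (z v w : 'rV[R]_n * 'rV[R]_n) : R :=
  (quad_h z (v + w) - quad_h z v - quad_h z w) / 2.

End PseudoRiemannianMetric.

(* Main.v *)
Require Import Defs.
From HB Require Import structures.
From mathcomp Require Import all_boot all_order all_algebra.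
From mathcomp Require Import all_classical all_reals all_analysis.
From mathcomp Require Import ring lra.
Import Order.TTheory GRing.Theory Num.Theory.
Import numFieldNormedType.Exports.
Local Open Scope classical_set_scope.
Local Open Scope ring_scope.
Set Implicit Arguments.
Unset Strict Implicit.
Unset Printing Implicit Defensive.

(** In a pair of charts let [C] be the cost, [F] the map [f], [P] and [Q = F o S]
    the two curves, [a = P'(0)], [b = Q'(0)], and [D_v] the derivative along [v].
    The local divergence [L (x, y) = C (x, F y) - phi x - kappa y] is nonnegative
    and vanishes on the diagonal, so [D_(u,0) L] vanishes there and the mixed
    Hessian of [L] is symmetric.  Lowering the index in the two geodesic equations
    then gives, for [u] tangent to [M] and [w] tangent to [M'],
      [D_P'' D_w C + D_a D_a D_w C = 0] and [D_u D_Q'' C + D_u D_b D_b C = 0],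
    and the chain rule turns the fourth derivative of [C (P s, Q t)] into
      [D_a D_a D_b D_b C + D_a D_a D_Q'' C].
    On the other side, curvature is tensorial, so [X] and [Y] may be replaced by
    the constant fields [a] and [b].  By the Koszul formula [nabla_a b] is
    [h]-orthogonal to everything and [nabla_b b] has the same products as [-Q''];
    metricity of [nabla] then yields [-2 sec = D_a D_a D_b D_b C + D_Q'' D_a D_a C]. *)

(** * Mean value inequality *)

(** The class [smooth_on] speaks only of iterated directional derivatives, whereas the chain rule
    needs a Frechet differential; hence the mean value inequality and the passage from continuous
    partial derivatives to a differential, in spaces with a finite [frame]. The connection [nabla]
    is known only through its axioms, so its tensoriality is derived from them, and [nabla_b b] is
    never computed: only its [h]-products occur, so [h] is not inverted. A matrix is inverted only
    in the Christoffel symbols, and there nondegeneracy of the cost enters: [g] is minus the product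
    of the cost matrix and the transposed Jacobian of [F], both invertible. The dual equation has
    two readings. It says that [D_Q'' C + D_b D_b C], which is the second [t]-derivative of
    [C (x, Q t)] at [0] as a function of [x], has zero differential at [P 0]; this removes the terms
    with [P''] from the fourth derivative. It also says that [nabla_b b + Q''] is [h]-orthogonal to
    everything, the geodesic equation of [h] at [0] for the curve [t -> (P 0, Q t)]. *)

Section MeanValue.
Variables (R : realType) (W : normedModType R).

(** The slack [e] absorbs the distance between the difference quotient and the derivative, so the
    estimate holds on both sides of [t]. *)
Lemma derivable_step (g : R -> W) (t M e : R) : 0 < e -> derivable g t 1 ->
  `|'D_1 g t| <= M ->
  exists2 d, 0 < d & forall h, `|h| < d -> `|g (h + t) - g t| <= (M + e) * `|h|.
Proof.
move=> e0 dg gM.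
have /cvgr_distC_le /(_ _ e0) H : (fun h => h^-1 *: ((g \o shift t) (h *: (1:R)) - g t)) @ 0^' --> 'D_1 g t.
  exact: dg.
have /nbhs_ballP [d /= d0 Hd] := H.
exists d => // h hd.
have [->|h0] := eqVneq h 0; first by rewrite add0r subrr !normr0 mulr0.
have := Hd h; rewrite /ball /= sub0r normrN => /(_ hd h0).
rewrite /= [h *: _]mulr1 => K.
have -> : g (h + t) - g t = h *: (h^-1 *: (g (h + t) - g t)).
  by rewrite scalerA mulfV// scale1r.
rewrite normrZ mulrC ler_wpM2r//.
rewrite -[X in `|X|](subrK ('D_1 g t)); apply: le_trans (ler_normD _ _) _.
by rewrite addrC lerD.
Qed.

(** For vector values there is no intermediate point, so the bound is propagated along [[0, 1]]:
    with slope [M + e], the set [S] of times up to which it holds has a supremum that lies in [S]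
    and cannot be smaller than 1. Then [e] tends to 0. *)
Lemma mean_value_norm (g : R -> W) (M : R) :
  (forall t : R, 0 <= t <= 1 -> derivable g t 1 /\ `|'D_1 g t| <= M) ->
  `|g 1 - g 0| <= M.
Proof.
move=> H; apply/ler_addgt0Pr => e e0.
have M0 : 0 <= M by have [|_] := H 0; [rewrite lexx ler01|exact: le_trans].
have Me0 : 0 <= M + e by rewrite addr_ge0// ltW.
pose S := [set t | 0 <= t <= 1 /\ `|g t - g 0| <= (M + e) * t].
have S0 : S 0 by split; rewrite ?lexx ?ler01// subrr normr0 mulr0.
have Sub : has_ubound S by exists 1 => t [/andP[]].
have hS : has_sup S by split; [exists 0|].
pose s := sup S.
have s0 : 0 <= s by apply: ub_le_sup.
have s1 : s <= 1 by apply: ge_sup; [exists 0|move=> t [/andP[]]].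
have s01 : 0 <= s <= 1 by rewrite s0 s1.
have [dgs gsM] := H s s01.
have [d d0 Hd] := derivable_step e0 dgs gsM.
(* The supremum is attained: a point of [S] within [d] of [s] is joined to [s] by one use of
   [derivable_step], taken backwards from [s]. *)
have Ss : `|g s - g 0| <= (M + e) * s.
  have [t St ts] := sup_adherent d0 hS.
  have tls : t <= s by apply: ub_le_sup.
  have st : `|t - s| < d by rewrite distrC ger0_norm ?subr_ge0// -/s ltrBlDr addrC -ltrBlDr.
  have := Hd _ st; rewrite subrK => K1.
  have K2 := proj2 St.
  rewrite distrC in K1.
  have -> : g s - g 0 = (g s - g t) + (g t - g 0) by rewrite addrA subrK.
  apply: (le_trans (ler_normD _ _)); apply: (le_trans (lerD K1 K2)).
  by rewrite distrC ger0_norm ?subr_ge0// -mulrDr subrK.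
have [s1'|s1'] := ltP s 1; last first.
  have es : s = 1 by apply/eqP; rewrite eq_le s1 s1'.
  by move: Ss; rewrite es mulr1.
exfalso.
(* A positive step shorter than [d] that stays in [[0, 1]] leads to a point of [S] beyond its
   supremum. *)
pose h := Num.min (d / 2) (1 - s).
have h0 : 0 < h by rewrite lt_min divr_gt0//= subr_gt0.
have hd : `|h| < d.
  by rewrite gtr0_norm// gt_min ltr_pdivrMr// ltr_pMr// ltr1n.
have hs1 : h + s <= 1 by rewrite -lerBrDr ge_min lexx orbT.
have : S (h + s).
  split; first by rewrite hs1 addr_ge0// ltW.
  have -> : g (h + s) - g 0 = (g (h + s) - g s) + (g s - g 0) by rewrite addrA subrK.
  apply: (le_trans (ler_normD _ _)); apply: (le_trans (lerD (Hd _ hd) Ss)).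
  by rewrite gtr0_norm// -mulrDr.
move=> /(ub_le_sup Sub); rewrite -/s.
by rewrite leNgt => /negP; apply; rewrite ltrDr.
Qed.

End MeanValue.

Section Derivatives.
Variable R : realType.

Lemma is_deriveP (V W : normedModType R) (f : V -> W) (x v : V) (l : W) :
  is_derive x v f l <->
  (fun h : R => h^-1 *: ((f \o shift x) (h *: v) - f x)) @ 0^' --> l.
Proof.
split=> [[H <-]|H]; first exact: H.
split; first by apply/cvg_ex; exists l.
exact: cvg_lim H.
Qed.

(** The difference quotient of the product is exactly [qa h *: f x + a x *: qf h + h *: (qa h *: qf
    h)], also at [h = 0] because [0^-1 = 0]; the last term tends to 0, and continuity of the factors
    is never invoked. *)
Lemma is_derive_scale (V W : normedModType R) (a : V -> R) (f : V -> W)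
    (x v : V) (da : R) (df : W) :
  is_derive x v a da -> is_derive x v f df ->
  is_derive x v (fun y => a y *: f y) (da *: f x + a x *: df).
Proof.
move=> /is_deriveP cA /is_deriveP cF.
apply/is_deriveP.
set qa := fun h : R => _ in cA; set qf := fun h : R => _ in cF.
have -> : (fun h : R => h^-1 *: (((fun y => a y *: f y) \o shift x) (h *: v) - a x *: f x))
  = (fun h => qa h *: f x + a x *: qf h + h *: (qa h *: qf h)).
  apply/funext => h; rewrite /qa /qf /=.
  have [->|h0] := eqVneq h 0.
    by rewrite invr0 !scale0r !scaler0 !addr0.
  rewrite [(h^-1 *: _ : R)]/(h^-1 * _) [h *: (_ *: _)]scalerA mulrA mulfV// mul1r.
  set u := a _; set w := f _.
  rewrite !scalerA [a x * h^-1]mulrC [(u - a x) * h^-1]mulrC -!scalerA -!scalerDr.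
  congr (_ *: _).
  by rewrite addrAC -scalerDr [f x + _]addrC subrK scalerBl scalerBr addrA subrK.
have -> : da *: f x + a x *: df = da *: f x + a x *: df + (0 : R) *: (da *: df).
  by rewrite scale0r addr0.
apply: cvgD.
  apply: cvgD; first exact: cvgZr_tmp.
  exact: cvgZl_tmp.
apply: cvgZ => //; last exact: cvgZ.
exact: cvg_within.
Qed.

Lemma is_derive_linear (V W W' : normedModType R) (L : {linear W -> W'})
    (f : V -> W) (x v : V) (df : W) : continuous L ->
  is_derive x v f df -> is_derive x v (L \o f) (L df).
Proof.
move=> cL /is_deriveP cF; apply/is_deriveP.
have -> : (fun h : R => h^-1 *: (((L \o f) \o shift x) (h *: v) - (L \o f) x)) =
   L \o (fun h : R => h^-1 *: ((f \o shift x) (h *: v) - f x)).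
  by apply/funext => h /=; rewrite linearZ_LR (raddfB L).
exact: (cvg_comp _ _ cF (cL df)).
Qed.

End Derivatives.

Section Segment.
Variables (R : realType) (V W : normedModType R).

(** Subtracting the linear path [t *: L] before using [mean_value_norm] turns a bound on a
    derivative into a bound on the error of a linear approximation. *)
Lemma mean_value_segment (f : V -> W) (x v : V) (L : W) (M : R) :
  (forall t : R, 0 <= t <= 1 -> derivable f (t *: v + x) v /\
     `|'D_v f (t *: v + x) - L| <= M) ->
  `|f (v + x) - f x - L| <= M.
Proof.
move=> H.
pose g (t : R) := f (t *: v + x).
have Eq t : (fun h : R => h^-1 *: ((g \o shift t) (h *: (1 : R)) - g t)) =
            (fun h : R => h^-1 *: ((f \o shift (t *: v + x)) (h *: v) - f (t *: v + x))).
  by apply/funext => h; rewrite /g /= [h *: (1:R)]mulr1 scalerDl addrA.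
have dg (t : R) : 0 <= t <= 1 -> is_derive t (1 : R) g ('D_v f (t *: v + x)).
  move=> /H [df _]; split; first by rewrite /derivable Eq.
  by rewrite /derive Eq.
pose k : R -> W := g - (fun t => t *: L).
have dk (t : R) : 0 <= t <= 1 -> is_derive t (1 : R) k ('D_v f (t *: v + x) - L).
  move=> /dg ?.
  have ? : is_derive t (1 : R) (fun t : R => t *: L) L.
    have := @is_derive_scale _ _ _ id (cst L) t 1 1 0 _ _.
    by rewrite scaler0 addr0 scale1r; apply; apply: is_derive_eq.
  exact: is_deriveB.
have := @mean_value_norm _ _ k M.
rewrite /k /g !fctE !scale1r !scale0r subr0 add0r addrAC; apply => t t01.
have [dkt kt] := dk t t01; split=> //.
by rewrite kt; have [] := H t t01.
Qed.

End Segment.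

(** * Continuously differentiable maps are differentiable *)

(** Stands for finite dimension: a finite spanning family with continuous linear coordinates. Rows
    and products share this interface, so a product needs no renumbering of its basis. *)
Record frame (R : realType) (V : normedModType R) := Frame {
  frame_idx : finType;
  frame_vec : frame_idx -> V;
  frame_coord : frame_idx -> {linear V -> R};
  frame_coord_continuous : forall i, continuous (frame_coord i);
  frame_sum : forall v, v = \sum_i frame_coord i v *: frame_vec i }.

Section Directions.
Variables (R : realType) (V W : normedModType R).

Lemma is_derive_dirZ (f : V -> W) (x v : V) (c : R) (df : W) :
  is_derive x v f df -> is_derive x (c *: v) f (c *: df).
Proof.
have [->|c0] := eqVneq c 0.
  by rewrite !scale0r => _; exact: is_derive0.
move=> /is_deriveP cF; apply/is_deriveP.
set q := fun h : R => _ in cF.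
have -> : (fun h : R => h^-1 *: ((f \o shift x) (h *: (c *: v)) - f x)) =
    (fun h => c *: (q \o (fun h => h * c)) h).
  apply/funext => h; rewrite /q /= scalerA [in RHS]scalerA invfM.
  by rewrite mulrCA mulfV// mulr1.
have H : (fun h : R => h * c) @ 0^' --> (0 : R)^'.
  move=> A /nbhs_ballP [d /= d0 Hd].
  apply/nbhs_ballP; exists (d / `|c|) => /=; first by rewrite divr_gt0// normr_gt0.
  move=> h; rewrite /ball /= sub0r normrN ltr_pdivlMr ?normr_gt0// => hd h0.
  apply: Hd; first by rewrite /ball /= sub0r normrN normrM.
  by rewrite mulf_neq0.
apply: cvgZl_tmp.
exact: (cvg_comp _ _ H cF).
Qed.

End Directions.

Section ContinuouslyDifferentiable.
Variables (R : realType) (V W : normedModType R) (E : frame V).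

Let e := @frame_vec R V E.
Let l := @frame_coord R V E.

(** The path from [x] to the displaced point runs along one frame vector after another. Each leg is
    estimated by the mean value inequality and the continuity of one partial derivative; stating
    this for a list of indices permits induction. *)
Lemma C1_telescope (U : set V) (f : V -> W) (x : V) (r : seq (frame_idx E)) :
  open U -> U x ->
  (forall v y, U y -> derivable f y v) ->
  (forall v, {for x, continuous ('D_v f)}) ->
  forall eps : R, 0 < eps ->
  \forall h \near (0 : V),
    `|f (\sum_(i <- r) l i h *: e i + x) - f x -
      \sum_(i <- r) l i h *: 'D_(e i) f x| <= eps * `|h|.
Proof.
move=> oU Ux df cf; elim: r => [|i r IH] eps eps0.
  near=> h; rewrite !big_nil add0r !subrr normr0.
  by rewrite mulr_ge0// ltW.
have [k k0 lk] := linear_lipschitz (@frame_coord_continuous _ _ E i).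
have {}lk h : `|l i h| <= k * `|h| by exact: lk.
(* Half of [eps] goes to the new leg and half to the induction hypothesis; dividing by the Lipschitz
   constant [k] of the coordinate compensates the length of the leg, at most [k] times the norm of
   [h]. *)
pose eps' := eps / 2 / k.
have eps'0 : 0 < eps' by rewrite !divr_gt0.
have : \forall y \near x, U y /\ `|'D_(e i) f x - 'D_(e i) f y| <= eps'.
  have /cvgr_dist_le /(_ _ eps'0) cfi := cf (e i).
  by near=> y; split; near: y; [exact: open_nbhs_nbhs|exact: cfi].
move=> /nbhs_ballP [d /= d0 Hd].
have cl j : continuous (l j) by exact: frame_coord_continuous.
pose S (h : V) := \sum_(i <- r) l i h *: e i.
have S0 : S @ (0 : V) --> (0 : V).
  suff : S @ (0 : V) --> S 0.
    by have -> : S 0 = 0 by rewrite /S big1// => j _; rewrite linear0 scale0r.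
  rewrite /S; elim: (r) => [|j s IHs].
    under eq_fun do rewrite big_nil.
    by rewrite big_nil; exact: cvg_cst.
  under eq_fun do rewrite big_cons.
  by rewrite big_cons; apply: cvgD => //; apply: cvgZr_tmp; exact: cl.
have T0 : (fun h => l i h *: e i) @ (0 : V) --> (0 : V).
  rewrite -[X in _ --> X](scale0r (e i)) -(linear0 (l i)).
  by apply: cvgZr_tmp; exact: cl.
near=> h.
rewrite !big_cons -/(S h).
have Sd : `|S h| < d / 2.
  rewrite -normrN -sub0r.
  by near: h; move/cvgr_dist_lt: S0; apply; rewrite divr_gt0.
have Td : `|l i h *: e i| < d / 2.
  rewrite -normrN -sub0r.
  by near: h; move/cvgr_dist_lt: T0; apply; rewrite divr_gt0.
have IHh : `|f (S h + x) - f x - \sum_(j <- r) l j h *: 'D_(e j) f x| <= eps / 2 * `|h|.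
  by near: h; apply: IH; rewrite divr_gt0.
have MV : `|f (l i h *: e i + (S h + x)) - f (S h + x) - l i h *: 'D_(e i) f x| <= eps / 2 * `|h|.
  apply: mean_value_segment => t t01.
  have [|Uy Dy] := Hd (t *: (l i h *: e i) + (S h + x)).
    rewrite -ball_normE /= addrA opprD addrCA subrr addr0 normrN.
    apply: (le_lt_trans (ler_normD _ _)); rewrite [d]splitr ltrD//.
    rewrite normrZ; apply: le_lt_trans Td.
    case/andP: t01 => t0 t1; rewrite ger0_norm//.
    by rewrite ler_piMl.
  have [Hd1 Hd2] := is_derive_dirZ (l i h) (derivableP (df (e i) _ Uy)).
  split=> //; rewrite Hd2 -scalerBr normrZ.
  apply: (@le_trans _ _ (k * `|h| * eps')).
    by rewrite ler_pM// distrC.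
  have -> : k * `|h| * eps' = eps / 2 * `|h| by rewrite /eps'; field; rewrite gt_eqF.
  exact: lexx.
rewrite -[_ *: _ + S h + x]addrA [eps]splitr mulrDl.
set A := f (_ + (S h + x)) in MV *; set B := f (S h + x) in MV IHh *.
set s := \sum_(j <- r) _ in IHh *; set t := l i h *: 'D_(e i) f x in MV *.
have -> : A - f x - (t + s) = (A - B - t) + (B - f x - s).
  by rewrite addrACA [A - B + _]addrA subrK -opprD.
by rewrite (le_trans (ler_normD _ _))// lerD.
Unshelve. all: by end_near. Qed.


(** Over all indices the path of [C1_telescope] ends at [h + x], by [frame_sum]. The estimate then
    exhibits [L] as a linear first-order approximation, and uniqueness identifies it with the
    differential. *)
Lemma C1_differentiable (U : set V) (f : V -> W) (x : V) :
  open U -> U x ->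
  (forall v y, U y -> derivable f y v) ->
  (forall v, {for x, continuous ('D_v f)}) ->
  differentiable f x.
Proof.
move=> oU Ux df cf.
pose L (h : V) := \sum_i l i h *: 'D_(e i) f x.
have linL : linear L.
  move=> a u v; rewrite /L scaler_sumr -big_split; apply: eq_bigr => i _.
  by rewrite /= linearP scalerDl scalerA.
pose LL : {linear V -> W} := HB.pack L (GRing.isLinear.Build _ _ _ _ L linL).
have cL : continuous LL.
  suff : continuous L by [].
  move=> y; rewrite /L; elim: (index_enum _) => [|i r IH].
    under eq_fun do rewrite big_nil.
    exact: cvg_cst.
  under eq_fun do rewrite big_cons.
  by apply: cvgD => //; apply: cvgZr_tmp; exact: frame_coord_continuous.
have H : f \o shift x = cst (f x) + LL +o_ (0 : V) id.
  apply/eqaddoP => eps eps0.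
  have := @C1_telescope U f x (index_enum _) oU Ux df cf eps eps0.
  apply: filterS => h; rewrite -frame_sum /= !fctE /=.
  by rewrite opprD addrA.
have D := diff_unique cL H.
apply/diff_locallyP; rewrite D; split=> //.
Qed.

End ContinuouslyDifferentiable.

(** * Chain rule and symmetry of second derivatives *)

Section PartialDerivative.
Variables (R : realType) (V W : normedModType R).

(* Locked, so that unification never unfolds one derivative into another. *)
Fact pd_key : unit. Proof. exact: tt. Qed.
Definition pd : V -> (V -> W) -> V -> W :=
  locked_with pd_key (fun v f => 'D_v f).

Lemma pdE (v : V) (f : V -> W) : 'D_v f = pd v f.
Proof. by rewrite /pd unlock. Qed.

Lemma pdxE (v : V) (f : V -> W) (x : V) : 'D_v f x = pd v f x.
Proof. by rewrite -pdE. Qed.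

Lemma pd_val (x v : V) (f : V -> W) (d : W) : is_derive x v f d -> pd v f x = d.
Proof. by rewrite -pdE => -[]. Qed.

Lemma derivable_is_derive (x v : V) (f : V -> W) :
  derivable f x v -> is_derive x v f (pd v f x).
Proof. by rewrite -pdE => /derivableP. Qed.

Lemma is_derive_ext (U : set V) (f g : V -> W) (x v : V) (d : W) :
  open U -> U x -> (forall y, U y -> f y = g y) ->
  is_derive x v f d -> is_derive x v g d.
Proof.
move=> oU Ux fg; apply: near_eq_is_derive.
by near=> y; apply: fg; near: y; exact: open_nbhs_nbhs.
Unshelve. all: by end_near. Qed.

Lemma pd_ext (U : set V) (f g : V -> W) (v x : V) :
  open U -> (forall y, U y -> f y = g y) -> U x -> pd v f x = pd v g x.
Proof.
move=> oU fg Ux; rewrite -!pdE.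
apply: near_eq_derive.
by near=> y; apply: fg; near: y; exact: open_nbhs_nbhs.
Unshelve. all: by end_near. Qed.

Lemma pd_linear (f : V -> W) (x : V) (a : R) (u v : V) : differentiable f x ->
  pd (a *: u + v) f x = a *: pd u f x + pd v f x.
Proof. by move=> df; rewrite -!pdE !deriveE// linearP. Qed.

Lemma pd0 (f : V -> W) (x : V) : pd 0 f x = 0.
Proof. by rewrite -pdE derive0. Qed.

Lemma pd_sumZ (I : Type) (r : seq I) (a : I -> R) (e : I -> V) (f : V -> W)
    (x : V) : differentiable f x ->
  pd (\sum_(i <- r) a i *: e i) f x = \sum_(i <- r) a i *: pd (e i) f x.
Proof.
move=> df; elim: r => [|i r IH]; first by rewrite !big_nil pd0.
by rewrite !big_cons pd_linear// IH.
Qed.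

End PartialDerivative.

Section ChainRule.
Variables (R : realType) (V1 V2 W : normedModType R).

(** Since [f] is derivable only along [v], it need not have a differential. Its restriction [phi] to
    the line through [x] has one, because in one variable derivable and differentiable agree; the
    differentials of [phi] and [g] are then composed. *)
Lemma is_derive_chain (f : V1 -> V2) (g : V2 -> W) (x v : V1) (df : V2) :
  differentiable g (f x) -> is_derive x v f df ->
  is_derive x v (g \o f) (pd df g (f x)).
Proof.
move=> dg [dfx <-].
pose phi (h : R) := f (h *: v + x).
have phi0 : phi 0 = f x by rewrite /phi scale0r add0r.
have dphi : derivable phi 0 1 by move/derivable1P : dfx.
have Dphi : differentiable phi 0 by exact/derivable1_diffP.
have dgp : differentiable g (phi 0) by rewrite phi0.
have dgf : differentiable (g \o phi) 0 by exact: differentiable_comp.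
have Eq (Z : normedModType R) (k : V1 -> Z) :
    (fun h : R => h^-1 *: (((fun h => k (h *: v + x)) \o shift 0) (h *: (1 : R)) - k (0 *: v + x))) =
    (fun h : R => h^-1 *: ((k \o shift x) (h *: v) - k x)).
  by apply/funext => h; rewrite /= addr0 [h *: (1:R)]mulr1 scale0r add0r.
have D1 : 'D_1 phi 0 = 'D_v f x by rewrite /derive -Eq.
have D2 : derivable (g \o phi) 0 1 by exact/derivable1_diffP.
split.
  by rewrite /derivable -Eq.
rewrite -pdE [RHS]deriveE// -D1 -phi0 (deriveE _ Dphi).
rewrite -[RHS]/(('d g (phi 0) \o 'd phi 0) 1) -diff_comp// -deriveE//.
by rewrite /derive -Eq.
Qed.

End ChainRule.

Section Symmetry.
Variables (R : realType) (V W : normedModType R).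

Lemma second_difference (U : set V) (f : V -> W) (x u v : V) (eps : R) :
  open U -> U x ->
  (forall w y, U y -> derivable f y w) ->
  (forall y, U y -> derivable (pd u f) y v) ->
  {for x, continuous (pd v (pd u f))} -> 0 < eps ->
  \forall s \near (0 : R)^',
    `|f (s *: u + (s *: v + x)) - f (s *: v + x) - (f (s *: u + x) - f x)
      - s ^+ 2 *: pd v (pd u f) x| <= eps * s ^+ 2.
Proof.
move=> oU Ux df ddf cf eps0.
have /cvgr_dist_le /(_ _ eps0) cfe := cf.
have : \forall y \near x, U y /\ `|pd v (pd u f) x - pd v (pd u f) y| <= eps.
  by near=> y; split; near: y; [exact: open_nbhs_nbhs|exact: cfe].
move=> /nbhs_ballP [d /= d0 Hd].
have nz (w : V) : (fun s : R => s *: w) @ (0 : R)^' --> (0 : V).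
  rewrite -[X in _ --> X](scale0r w); apply: cvgZr_tmp.
  exact: cvg_within.
have d2 : 0 < d / 2 by rewrite divr_gt0.
near=> s.
have s0 : s != 0 by near: s; exact: nbhs_dnbhs_neq.
have su : `|s *: u| < d / 2.
  by rewrite -normrN -sub0r; near: s; move/cvgr_dist_lt: (nz u); apply.
have sv : `|s *: v| < d / 2.
  by rewrite -normrN -sub0r; near: s; move/cvgr_dist_lt: (nz v); apply.
have small (t t' : R) : 0 <= t <= 1 -> 0 <= t' <= 1 ->
    ball x d (t' *: (s *: v) + (t *: (s *: u) + x)).
  move=> /andP[t0 t1] /andP[t'0 t'1].
  rewrite -ball_normE /= addrA opprD addrCA subrr addr0 normrN.
  apply: (le_lt_trans (ler_normD _ _)); rewrite [d]splitr ltrD//.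
    by rewrite normrZ; apply: le_lt_trans sv; rewrite ger0_norm// ler_piMl.
  by rewrite normrZ; apply: le_lt_trans su; rewrite ger0_norm// ler_piMl.
have one : 0 <= (1 : R) <= 1 by rewrite lexx ler01.
have zero : 0 <= (0 : R) <= 1 by rewrite lexx ler01.
(* The second difference is a first difference of [k] along [s *: u], and the derivative of [k] is
   in turn a first difference of [pd u f] along [s *: v]; so the mean value inequality is used
   twice. *)
pose k (y : V) := f (s *: v + y) - f y.
have -> : f (s *: u + (s *: v + x)) - f (s *: v + x) - (f (s *: u + x) - f x) =
    k (s *: u + x) - k x.
  rewrite /k [s *: u + (s *: v + _)]addrCA !opprB addrACA [RHS]addrACA.
  by rewrite (addrC (- f (s *: u + x))).
apply: mean_value_segment => t t01.
pose y := t *: (s *: u) + x.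
have Uy : U y.
  have := small t 0 t01 zero.
  by rewrite scale0r add0r => /Hd[].
have Usy : U (s *: v + y).
  by have := small t 1 t01 one; rewrite scale1r => /Hd[].
have dk : is_derive y (s *: u) k (s *: (pd u f (s *: v + y) - pd u f y)).
  rewrite scalerBr; apply: is_deriveB; last first.
    by apply: is_derive_dirZ; apply: derivable_is_derive; exact: df.
  apply: is_derive_dirZ.
  have Hs := derivable_is_derive (df u _ Usy).
  move/is_deriveP : Hs => Hs; apply/is_deriveP.
  by under eq_fun => h do rewrite /= addrCA.
split; first by case: dk.
rewrite -/y (@derive_val _ _ _ _ _ _ _ dk).
have H : `|pd u f (s *: v + y) - pd u f y - s *: pd v (pd u f) x| <= eps * `|s|.
  apply: mean_value_segment => t' t'01.
  have [Uz Hz] := Hd _ (small t t' t01 t'01); rewrite -/y in Uz Hz.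
  have Dz := is_derive_dirZ s (derivable_is_derive (ddf _ Uz)).
  split; first by case: Dz.
  rewrite (@derive_val _ _ _ _ _ _ _ Dz) -scalerBr normrZ mulrC.
  by rewrite ler_pM// distrC.
have -> : eps * s ^+ 2 = `|s| * (eps * `|s|).
  by rewrite [RHS]mulrCA -(normrM s s) ger0_norm -expr2// sqr_ge0.
by rewrite expr2 -scalerA -scalerBr normrZ ler_wpM2l.
Unshelve. all: by end_near. Qed.

(** The second difference is symmetric in [u] and [v]; divided by [s ^+ 2] it lies within [eps / 2]
    of each of the two mixed derivatives. *)
Lemma pd_comm (U : set V) (f : V -> W) (x u v : V) :
  open U -> U x ->
  (forall w y, U y -> derivable f y w) ->
  (forall w w' y, U y -> derivable (pd w f) y w') ->
  (forall w w', {for x, continuous (pd w (pd w' f))}) ->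
  pd u (pd v f) x = pd v (pd u f) x.
Proof.
move=> oU Ux df ddf cf.
apply/eqP; rewrite -subr_eq0 -normr_le0; apply/ler_addgt0Pr => eps eps0.
rewrite add0r.
have e2 : 0 < eps / 2 by rewrite divr_gt0.
have H1 := @second_difference U f x u v _ oU Ux df (ddf u v) (cf v u) e2.
have H2 := @second_difference U f x v u _ oU Ux df (ddf v u) (cf u v) e2.
have := filter_ex (filterI (filterI H1 H2) (nbhs_dnbhs_neq (0 : R))).
case=> s [[/=]].
set a := f (_ + _) - _ - _; set b := f (_ + _) - _ - _.
have -> : b = a.
  rewrite /a /b [s *: u + (s *: v + _)]addrCA !opprB addrACA [RHS]addrACA.
  by rewrite (addrC (- f (s *: u + x))).
move=> K1 K2 s0.
have s2 : 0 < s ^+ 2 by rewrite exprn_even_gt0.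
rewrite -(ler_pM2l s2) -[X in X * `|_|]ger0_norm ?(ltW s2)// -normrZ scalerBr.
rewrite [eps]splitr mulrDr [_ * (eps / 2)]mulrC.
apply: le_trans (lerD K1 K2).
rewrite (distrC a (_ *: pd u _ _)); apply: le_trans (ler_normD _ _).
by rewrite [X in _ <= `|X|]addrC addrA subrK.
Qed.

End Symmetry.

(** * Closure properties of differentiability classes *)

Section CkClosure.
Variable R : realType.

Section Basics.
Variables (V W : normedModType R).
Implicit Types (U : set V) (f g : V -> W) (k : nat).

Lemma Ck_continuous k U f x : Ck_on k U f -> U x -> {for x, continuous f}.
Proof. by case: k => [|k] [cf _]; exact: cf. Qed.

Lemma Ck_derivable k U f v x : Ck_on k.+1 U f -> U x -> derivable f x v.
Proof. by move=> [_ /(_ v) [df _]]; exact: df. Qed.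

Lemma Ck_pd k U f v : Ck_on k.+1 U f -> Ck_on k U (pd v f).
Proof. by rewrite -pdE => -[_ /(_ v) []]. Qed.

Lemma CkS k U f : (forall x, U x -> {for x, continuous f}) ->
  (forall v x, U x -> derivable f x v) -> (forall v, Ck_on k U (pd v f)) ->
  Ck_on k.+1 U f.
Proof. by move=> cf df kf; split=> // v; split; [exact: df|rewrite pdE]. Qed.

Lemma Ck_is_derive k U f v x : Ck_on k.+1 U f -> U x -> is_derive x v f (pd v f x).
Proof. by move=> kf Ux; apply: derivable_is_derive; exact: Ck_derivable kf Ux. Qed.

Lemma Ck_succ k U f : Ck_on k.+1 U f -> Ck_on k U f.
Proof.
elim: k f => [|k IH] f kf; first by split=> // x; exact: Ck_continuous kf.
apply: CkS => [x|v x|v]; first exact: Ck_continuous kf.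
- exact: Ck_derivable kf.
- by apply: IH; exact: Ck_pd.
Qed.

Lemma Ck_sub k U U' f : (forall x, U' x -> U x) -> Ck_on k U f -> Ck_on k U' f.
Proof.
move=> sub; elim: k f => [|k IH] f kf.
  by split=> // x /sub; exact: Ck_continuous kf.
apply: CkS => [x|v x|v]; first by move=> /sub; exact: Ck_continuous kf.
- by move=> /sub; exact: Ck_derivable kf.
- by apply: IH; exact: Ck_pd.
Qed.

Lemma Ck_ext k U f g : open U -> (forall x, U x -> f x = g x) ->
  Ck_on k U f -> Ck_on k U g.
Proof.
move=> oU; elim: k f g => [|k IH] f g fg kf.
  split=> // x Ux; have cf := Ck_continuous kf Ux.
  rewrite /prop_for /continuous_at -(fg x Ux); apply: cvg_trans cf.
  apply: near_eq_cvg; near=> y; apply: fg; near: y; exact: open_nbhs_nbhs.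
apply: CkS => [x Ux|v x Ux|v].
- have cf := Ck_continuous kf Ux.
  rewrite /prop_for /continuous_at -(fg x Ux); apply: cvg_trans cf.
  apply: near_eq_cvg; near=> y; apply: fg; near: y; exact: open_nbhs_nbhs.
- by have [] := is_derive_ext oU Ux fg (Ck_is_derive v kf Ux).
- apply: (IH (pd v f)); last exact: Ck_pd.
  by move=> x Ux; apply: pd_ext Ux.
Unshelve. all: by end_near. Qed.

Lemma Ck_cst k U (w : W) : Ck_on k U (fun=> w).
Proof.
elim: k w => [|k IH] w; first by split=> // x _; exact: cst_continuous.
apply: CkS => [x _|v x _|v]; first exact: cst_continuous.
- exact: derivable_cst.
- have -> : pd v (fun=> w) = fun=> 0; last exact: IH.
  by apply/funext => x; apply: pd_val; exact: is_derive_cst.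
Qed.

Lemma Ck_linear k U (L : {linear V -> W}) : continuous L -> Ck_on k U L.
Proof.
move=> cL; case: k => [|k]; first by split=> // x _; exact: cL.
have D v x : is_derive x v L (L v).
  exact: (is_derive_linear cL (is_derive_id x v)).
apply: CkS => [x _|v x _|v]; [exact: cL|by have [] := D v x|].
have -> : pd v L = fun=> L v by apply/funext => x; exact: pd_val.
exact: Ck_cst.
Qed.

Lemma Ck_add k U f g : open U -> Ck_on k U f -> Ck_on k U g ->
  Ck_on k U (fun x => f x + g x).
Proof.
move=> oU; elim: k f g => [|k IH] f g kf kg.
  by split=> // x Ux; apply: cvgD; [exact: Ck_continuous kf Ux|exact: Ck_continuous kg Ux].
have D v x : U x -> is_derive x v (fun y => f y + g y) (pd v f x + pd v g x).
  by move=> Ux; apply: is_deriveD; [exact: Ck_is_derive kf Ux|exact: Ck_is_derive kg Ux].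
apply: CkS => [x Ux|v x Ux|v].
- by apply: cvgD; [exact: Ck_continuous kf Ux|exact: Ck_continuous kg Ux].
- by have [] := D v x Ux.
- apply: (@Ck_ext _ _ (fun x => pd v f x + pd v g x)) => // [x Ux|].
    by rewrite (pd_val (D v x Ux)).
  by apply: IH; exact: Ck_pd.
Qed.

Lemma Ck_sum k U (I : Type) (r : seq I) (F : I -> V -> W) : open U ->
  (forall i, Ck_on k U (F i)) -> Ck_on k U (fun x => \sum_(i <- r) F i x).
Proof.
move=> oU kF; elim: r => [|i r IH].
  by under eq_fun do rewrite big_nil; exact: Ck_cst.
by under eq_fun do rewrite big_cons; exact: Ck_add.
Qed.

End Basics.

Lemma Ck_scale (V W : normedModType R) k (U : set V) (a : V -> R) (f : V -> W) :
  open U -> Ck_on k U a -> Ck_on k U f ->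
  Ck_on k U (fun x => a x *: f x).
Proof.
move=> oU; elim: k a f => [|k IH] a f ka kf.
  by split=> // x Ux; exact: (cvgZ (Ck_continuous ka Ux) (Ck_continuous kf Ux)).
have D v x : U x -> is_derive x v (fun y => a y *: f y) (pd v a x *: f x + a x *: pd v f x).
  by move=> Ux; apply: is_derive_scale; [exact: Ck_is_derive ka Ux|exact: Ck_is_derive kf Ux].
apply: CkS => [x Ux|v x Ux|v].
- by exact: (cvgZ (Ck_continuous ka Ux) (Ck_continuous kf Ux)).
- by have [] := D v x Ux.
- apply: (@Ck_ext _ _ _ _ (fun x => pd v a x *: f x + a x *: pd v f x)) => // [x Ux|].
    by rewrite (pd_val (D v x Ux)).
  by apply: Ck_add => //; apply: IH => //; (exact: Ck_pd || exact: Ck_succ).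
Qed.

Lemma Ck_linear_comp (V W W' : normedModType R) k (U : set V)
    (L : {linear W -> W'}) (f : V -> W) : open U -> continuous L ->
  Ck_on k U f -> Ck_on k U (fun x => L (f x)).
Proof.
move=> oU cL; elim: k f => [|k IH] f kf.
  split=> // x Ux; apply: (cvg_comp _ _ (Ck_continuous kf Ux)); exact: cL.
have D v x : U x -> is_derive x v (fun y => L (f y)) (L (pd v f x)).
  by move=> Ux; apply: is_derive_linear => //; exact: Ck_is_derive kf Ux.
apply: CkS => [x Ux|v x Ux|v].
- apply: (cvg_comp _ _ (Ck_continuous kf Ux)); exact: cL.
- by have [] := D v x Ux.
- apply: (@Ck_ext _ _ _ _ (fun x => L (pd v f x))) => // [x Ux|].
    by rewrite (pd_val (D v x Ux)).
  by apply: IH; exact: Ck_pd.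
Qed.

Lemma is_derive_pair (V W W' : normedModType R) (f : V -> W) (g : V -> W')
    (x v : V) (df : W) (dg : W') : is_derive x v f df -> is_derive x v g dg ->
  is_derive x v (fun y => (f y, g y)) (df, dg).
Proof.
move=> /is_deriveP cf /is_deriveP cg; apply/is_deriveP.
exact: cvg_pair cf cg.
Qed.

Lemma Ck_pair (V W W' : normedModType R) k (U : set V) (f : V -> W)
    (g : V -> W') : open U -> Ck_on k U f -> Ck_on k U g ->
  Ck_on k U (fun x => (f x, g x)).
Proof.
move=> oU; elim: k f g => [|k IH] f g kf kg.
  by split=> // x Ux; apply: cvg_pair; [exact: Ck_continuous kf Ux|exact: Ck_continuous kg Ux].
have D v x : U x -> is_derive x v (fun y => (f y, g y)) (pd v f x, pd v g x).
  by move=> Ux; apply: is_derive_pair; [exact: Ck_is_derive kf Ux|exact: Ck_is_derive kg Ux].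
apply: CkS => [x Ux|v x Ux|v].
- by apply: cvg_pair; [exact: Ck_continuous kf Ux|exact: Ck_continuous kg Ux].
- by have [] := D v x Ux.
- apply: (@Ck_ext _ _ _ _ (fun x => (pd v f x, pd v g x))) => // [x Ux|].
    by rewrite (pd_val (D v x Ux)).
  by apply: IH; exact: Ck_pd.
Qed.

Lemma Ck_differentiable (V W : normedModType R) (E : frame V) k (U : set V)
    (f : V -> W) x : open U -> Ck_on k.+1 U f -> U x -> differentiable f x.
Proof.
move=> oU kf Ux; apply: (C1_differentiable E oU Ux) => [v y Uy|v].
  exact: Ck_derivable kf Uy.
by rewrite pdE; exact: Ck_continuous (Ck_pd v kf) Ux.
Qed.

Lemma pd_chain (V1 V2 W : normedModType R) (E : frame V2) k k' (U : set V1)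
    (U2 : set V2) (f : V1 -> V2) (g : V2 -> W) x v : open U2 ->
  Ck_on k.+1 U f -> Ck_on k'.+1 U2 g -> U x -> U2 (f x) ->
  pd v (g \o f) x = pd (pd v f x) g (f x).
Proof.
move=> oU2 kf kg Ux U2x; apply: pd_val; apply: is_derive_chain.
  exact: (Ck_differentiable E oU2 kg).
exact: Ck_is_derive kf Ux.
Qed.

(** The derivative of the composite is a derivative of [g] in a direction that varies with the
    point. Expanding this direction in the frame gives a sum of products of a coordinate of [pd v f]
    and a composite with a fixed derivative of [g], to which induction applies. *)
Lemma Ck_comp (V1 V2 W : normedModType R) (E : frame V2) k (U : set V1)
    (U2 : set V2) (f : V1 -> V2) (g : V2 -> W) : open U -> open U2 ->
  (forall x, U x -> U2 (f x)) -> Ck_on k U f -> Ck_on k U2 g ->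
  Ck_on k U (g \o f).
Proof.
move=> oU oU2 fU; elim: k f g fU => [|k IH] f g fU kf kg.
  split=> // x Ux; apply: (cvg_comp _ _ (Ck_continuous kf Ux)).
  exact: Ck_continuous kg (fU _ Ux).
have D v x : U x -> is_derive x v (g \o f) (pd (pd v f x) g (f x)).
  move=> Ux; apply: is_derive_chain; first exact: (Ck_differentiable E oU2 kg (fU _ Ux)).
  exact: Ck_is_derive kf Ux.
apply: CkS => [x Ux|v x Ux|v].
- apply: (cvg_comp _ _ (Ck_continuous kf Ux)).
  exact: Ck_continuous kg (fU _ Ux).
- by have [] := D v x Ux.
- apply: (@Ck_ext _ _ _ _ (fun x => \sum_i frame_coord i (pd v f x) *:
     (pd (frame_vec i) g \o f) x)) => // [x Ux|].
    rewrite (pd_val (D v x Ux)) [in RHS](frame_sum E (pd v f x)) pd_sumZ//.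
    exact: (Ck_differentiable E oU2 kg (fU _ Ux)).
  apply: Ck_sum => // i; apply: Ck_scale => //.
    apply: Ck_linear_comp => //; first exact: frame_coord_continuous.
    exact: Ck_pd.
  by apply: IH => //; [exact: Ck_succ|exact: Ck_pd].
Qed.

End CkClosure.

Section SecondDerivative.
Variables (R : realType) (V W : normedModType R).

Lemma is_derive_bigsum (I : Type) (r : seq I) (F : I -> V -> W) (dF : I -> W)
    (x v : V) : (forall i, is_derive x v (F i) (dF i)) ->
  is_derive x v (fun y => \sum_(i <- r) F i y) (\sum_(i <- r) dF i).
Proof.
move=> D; elim: r => [|i r IH].
  under eq_fun do rewrite big_nil.
  by rewrite big_nil; exact: is_derive_cst.
under eq_fun do rewrite big_cons.
by rewrite big_cons; exact: is_deriveD.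
Qed.

Lemma Ck_pd_comm (U : set V) (f : V -> W) (x u v : V) : open U ->
  Ck_on 2 U f -> U x -> pd u (pd v f) x = pd v (pd u f) x.
Proof.
move=> oU kf Ux; apply: (@pd_comm _ _ _ U f x u v oU Ux) => [w y Uy|w w' y Uy|w w'].
- exact: Ck_derivable kf Uy.
- exact: Ck_derivable (Ck_pd w kf) Uy.
- exact: Ck_continuous (Ck_pd _ (Ck_pd w' kf)) Ux.
Qed.

End SecondDerivative.

Section SecondDerivativeComp.
Variables (R : realType) (V0 V W : normedModType R) (E : frame V).

Lemma pd_pd_comp (U0 : set V0) (U : set V) (f : V0 -> V) (g : V -> W)
    (x v : V0) : open U0 -> open U -> (forall y, U0 y -> U (f y)) ->
  Ck_on 2 U0 f -> Ck_on 2 U g -> U0 x ->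
  pd v (pd v (g \o f)) x =
    pd (pd v (pd v f) x) g (f x) + pd (pd v f x) (pd (pd v f x) g) (f x).
Proof.
move=> oU0 oU fU kf kg Ux.
have dg y : U0 y -> differentiable g (f y).
  by move=> Uy; exact: (Ck_differentiable E oU kg (fU _ Uy)).
pose e := @frame_vec _ _ E; pose l := @frame_coord _ _ E.
rewrite (@pd_ext _ _ _ U0 _
  (fun y => \sum_i l i (pd v f y) *: (pd (e i) g \o f) y)) //; last first.
  move=> y Uy; rewrite (pd_chain E v oU kf kg Uy (fU _ Uy)).
  by rewrite [in LHS](frame_sum E (pd v f y)) pd_sumZ//; exact: dg.
pose df := pd v f x.
transitivity (\sum_i (l i (pd v (pd v f) x) *: pd (e i) g (f x) +
                      l i df *: pd df (pd (e i) g) (f x))).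
  apply: pd_val; apply: is_derive_bigsum => i.
  apply: is_derive_scale.
    apply: (is_derive_linear (@frame_coord_continuous _ _ E i)).
    exact: Ck_is_derive (Ck_pd v kf) Ux.
  have dgi := Ck_differentiable E oU (Ck_pd (e i) kg) (fU _ Ux).
  exact: (is_derive_chain dgi (Ck_is_derive v kf Ux)).
rewrite big_split /=; congr (_ + _).
  by rewrite [in RHS](frame_sum E (pd v (pd v f) x)) pd_sumZ//; exact: dg.
(* The product rule leaves the frame vector in the inner derivative, while the expansion of [df]
   puts it in the outer one; equality of mixed derivatives reconciles them. *)
rewrite -/df [X in _ = pd X _ _](frame_sum E df) pd_sumZ; last first.
  exact: (Ck_differentiable E oU (Ck_pd df kg) (fU _ Ux)).
apply: eq_bigr => i _; rewrite (Ck_pd_comm _ _ oU kg)//.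
exact: fU.
Qed.

End SecondDerivativeComp.

(** * Frames of row spaces and of products *)

Section Frames.
Variable R : realType.

Section RowFrame.
Variable n : nat.

(** A named function, so that the linear structure can be attached to it. *)
Definition row_coord (i : 'I_n) (v : 'rV[R]_n) : R := v 0 i.

Fact row_coord_linear (i : 'I_n) : linear (row_coord i).
Proof. rewrite /row_coord; by move=> a u v; rewrite !mxE. Qed.
HB.instance Definition _ (i : 'I_n) :=
  GRing.isLinear.Build _ _ _ _ (row_coord i) (row_coord_linear i).

Definition frame_row : frame 'rV[R]_n.
Proof.
refine (@Frame R _ 'I_n (fun i => delta_mx 0 i) (fun i => row_coord i : {linear _ -> _}) _ _).
- by move=> i; exact: coord_continuous.
- exact: row_sum_delta.
Defined.

End RowFrame.

Section ProductFrame.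
Variables V W : normedModType R.

Lemma fst_continuous : continuous (fst : V * W -> V).
Proof. by move=> x; exact: cvg_fst. Qed.

Lemma snd_continuous : continuous (snd : V * W -> W).
Proof. by move=> x; exact: cvg_snd. Qed.

Definition frame_prod (E : frame V) (F : frame W) : frame (V * W)%type.
Proof.
refine (@Frame R _ (frame_idx E + frame_idx F)%type
  (fun k => match k with inl i => (frame_vec i, 0) | inr j => (0, frame_vec j) end)
  (fun k => match k with
            | inl i => (frame_coord i \o fst : {linear (V * W)%type -> R})
            | inr j => (frame_coord j \o snd : {linear (V * W)%type -> R}) end) _ _).
- move=> [i|j] x; apply: continuous_comp.
  + exact: fst_continuous.
  + exact: frame_coord_continuous.
  + exact: snd_continuous.
  + exact: frame_coord_continuous.
- move=> [v w]; rewrite big_sumType /=.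
  rewrite [LHS]surjective_pairing [RHS]surjective_pairing.
  congr pair; rewrite raddfD /= !raddf_sum /=.
  + rewrite [X in _ = _ + X]big1 ?addr0 => [|j _]; last exact: scaler0.
    exact: frame_sum.
  + rewrite [X in _ = X + _]big1 ?add0r => [|j _]; last exact: scaler0.
    exact: frame_sum.
Defined.

End ProductFrame.

End Frames.

(** * Connections and curvature *)

Section Connection.
Variables (R : realType) (V : normedModType R) (E : frame V).
Variables (U : set V) (nabla : (V -> V) -> (V -> V) -> V -> V).
Hypotheses (oU : open U) (conn : is_connection U nabla).

Let e := @frame_vec _ _ E.
Let l := @frame_coord _ _ E.

Let l_continuous i : continuous (l i).
Proof. exact: frame_coord_continuous. Qed.

Lemma smooth_cst (W : normedModType R) (w : W) : smooth_on U (fun=> w : W).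
Proof. by move=> k; exact: Ck_cst. Qed.

Lemma smooth_coord (Y : V -> V) i : smooth_on U Y -> smooth_on U (fun z => l i (Y z)).
Proof. by move=> sY k; apply: Ck_linear_comp. Qed.

Lemma smooth_pd (W : normedModType R) (f : V -> W) v :
  smooth_on U f -> smooth_on U (pd v f).
Proof. by move=> sf k; apply: Ck_pd. Qed.

Lemma smooth_scale (W : normedModType R) (a : V -> R) (f : V -> W) :
  smooth_on U a -> smooth_on U f -> smooth_on U (fun z => a z *: f z).
Proof. by move=> sa sf k; apply: Ck_scale. Qed.

Lemma smooth_bigsum (W : normedModType R) (I : Type) (r : seq I) (F : I -> V -> W) :
  (forall i, smooth_on U (F i)) -> smooth_on U (fun z => \sum_(i <- r) F i z).
Proof. by move=> sF k; apply: Ck_sum => // i; exact: sF. Qed.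

Lemma smooth_is_derive (W : normedModType R) (f : V -> W) v z :
  smooth_on U f -> U z -> is_derive z v f (pd v f z).
Proof. by move=> sf; apply: (Ck_is_derive (k := 0)); exact: sf. Qed.

Lemma smooth_nabla (X Y : V -> V) : smooth_on U X -> smooth_on U Y ->
  smooth_on U (nabla X Y).
Proof. exact: (connection_smooth conn). Qed.

Lemma nabla_sum_l (I : Type) (r : seq I) (a : I -> V -> R) (X : I -> V -> V)
    (Z : V -> V) z :
  (forall i, smooth_on U (a i)) -> (forall i, smooth_on U (X i)) ->
  smooth_on U Z -> U z ->
  nabla (fun w => \sum_(i <- r) a i w *: X i w) Z z =
    \sum_(i <- r) a i z *: nabla (X i) Z z.
Proof.
move=> sa sX sZ Uz; elim: r => [|i r IH].
  rewrite big_nil.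
  (* With coefficient [1] and zero fields, the linearity axiom makes the value at the zero field
     twice itself, hence zero. *)
  have H := connection_linear conn (smooth_cst (1 : R)) (smooth_cst (0 : V))
    (smooth_cst (0 : V)) sZ Uz.
  have {}H : nabla (fun=> 0) Z z = nabla (fun=> 0) Z z + nabla (fun=> 0) Z z.
    rewrite -[X in _ = X + _]scale1r -[RHS]H.
    by apply: (connection_ext conn) => // w _; rewrite scaler0 addr0.
  transitivity (nabla (fun=> 0) Z z).
    by apply: (connection_ext conn) => // w _; rewrite big_nil.
  by apply: (addIr (nabla (fun=> 0) Z z)); rewrite -H add0r.
rewrite big_cons -IH -(connection_linear conn)//.
  by apply: (connection_ext conn) => // w _; rewrite big_cons.
by apply: smooth_bigsum => j; exact: smooth_scale.
Qed.

Lemma nabla_frame (X Z : V -> V) z : smooth_on U X -> smooth_on U Z -> U z ->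
  nabla X Z z = \sum_i l i (X z) *: nabla (fun=> e i) Z z.
Proof.
move=> sX sZ Uz; rewrite -(nabla_sum_l _ (a := fun i w => l i (X w)))//.
- by apply: (connection_ext conn) => // w _; exact: frame_sum.
- by move=> i; exact: smooth_coord.
- by move=> i; exact: smooth_cst.
Qed.

(** By [nabla_frame] the first argument enters only through its coordinates at [z]; this is
    tensoriality in that argument. *)
Lemma nabla_point (X X' Z : V -> V) z : smooth_on U X -> smooth_on U X' ->
  smooth_on U Z -> U z -> X z = X' z -> nabla X Z z = nabla X' Z z.
Proof. by move=> sX sX' sZ Uz XX'; rewrite !nabla_frame// XX'. Qed.

Lemma nabla_addr (x : V) (Y Y' : V -> V) z :
  smooth_on U Y -> smooth_on U Y' -> U z ->
  nabla (fun=> x) (fun w => Y w + Y' w) z =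
    nabla (fun=> x) Y z + nabla (fun=> x) Y' z.
Proof.
move=> sY sY' Uz.
have H := connection_leibniz conn (smooth_cst (1 : R)) (smooth_cst x) sY sY' Uz.
transitivity (nabla (fun=> x) (fun w => 1 *: Y w + Y' w) z).
  by apply: (connection_ext conn) => // w _; rewrite scale1r.
by rewrite H pdxE (pd_val (is_derive_cst _ _ _)) scale0r add0r scale1r.
Qed.

Lemma nabla_sum_r (I : Type) (r : seq I) (a : I -> V -> R) (Y : I -> V -> V)
    (x : V) z :
  (forall i, smooth_on U (a i)) -> (forall i, smooth_on U (Y i)) -> U z ->
  nabla (fun=> x) (fun w => \sum_(i <- r) a i w *: Y i w) z =
    \sum_(i <- r) (pd x (a i) z *: Y i z + a i z *: nabla (fun=> x) (Y i) z).
Proof.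
move=> sa sY Uz; have sx := smooth_cst x; elim: r => [|i r IH].
  rewrite big_nil.
  have H : nabla (fun=> x) (fun=> 0) z = nabla (fun=> x) (fun=> 0) z + nabla (fun=> x) (fun=> 0) z.
    rewrite -nabla_addr//; try exact: smooth_cst.
    by apply: (connection_ext conn) => // w _; rewrite addr0.
  transitivity (nabla (fun=> x) (fun=> 0) z).
    by apply: (connection_ext conn) => // w _; rewrite big_nil.
  by apply: (addIr (nabla (fun=> x) (fun=> 0) z)); rewrite -H add0r.
rewrite big_cons -IH -pdxE -(connection_leibniz conn)//.
  by apply: (connection_ext conn) => // w _; rewrite big_cons.
by apply: smooth_bigsum => j; exact: smooth_scale.
Qed.

Lemma nabla_subl (x y : V) (Z : V -> V) z : smooth_on U Z -> U z ->
  nabla (fun=> x - y) Z z = nabla (fun=> x) Z z - nabla (fun=> y) Z z.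
Proof.
move=> sZ Uz.
have H := connection_linear conn (smooth_cst (-1 : R)) (smooth_cst y) (smooth_cst x) sZ Uz.
transitivity (nabla (fun=> -1 *: y + x) Z z).
  by apply: (connection_ext conn) => // w _; rewrite scaleN1r addrC.
by rewrite H addrC scaleN1r.
Qed.

(** With [Y] expanded in the frame, the Leibniz rule also differentiates its coordinates; these
    terms form the first summand, the price of freezing [Y] at [z]. In the curvature they are
    cancelled by the bracket term. *)
Lemma nabla_nabla (x : V) (Y Z : V -> V) z : smooth_on U Y -> smooth_on U Z -> U z ->
  nabla (fun=> x) (nabla Y Z) z =
  nabla (fun=> pd x Y z) Z z + nabla (fun=> x) (nabla (fun=> Y z) Z) z.
Proof.
move=> sY sZ Uz; have sx := smooth_cst x.
have sN i : smooth_on U (nabla (fun=> e i) Z) by apply: smooth_nabla => //; exact: smooth_cst.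
have nabla_r (F G : V -> V) : (forall w, U w -> F w = G w) ->
    nabla (fun=> x) F z = nabla (fun=> x) G z.
  by move=> FG; apply: (connection_ext conn).
rewrite (nabla_r _ (fun w => \sum_i l i (Y w) *: nabla (fun=> e i) Z w)); last first.
  by move=> w Uw; exact: nabla_frame.
rewrite (nabla_r (nabla (fun=> Y z) Z) (fun w => \sum_i l i (Y z) *: nabla (fun=> e i) Z w)); last first.
  by move=> w Uw; apply: (@nabla_frame (fun=> Y z)) => //; exact: smooth_cst.
rewrite (@nabla_sum_r _ _ (fun i w => l i (Y w)))//; last by move=> i; exact: smooth_coord.
rewrite (@nabla_sum_r _ _ (fun i _ => l i (Y z)))//; last by move=> i; exact: smooth_cst.
rewrite [nabla (fun=> pd x Y z) Z z]nabla_frame//; last exact: smooth_cst.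
rewrite -big_split; apply: eq_bigr => i _ /=.
congr (_ *: _ + _).
  apply: pd_val; apply: is_derive_linear => //; exact: smooth_is_derive.
by rewrite (pd_val (is_derive_cst _ _ _)) scale0r add0r.
Qed.

(** The commutator is tensorial in [Z]: terms with one derivative of the coordinates of [Z] are
    symmetric in [x] and [y] as a pair, and those with two derivatives are so by equality of mixed
    derivatives. The remaining terms involve only [Z z]. *)
Lemma nabla_nabla_const (x y : V) (Z : V -> V) z : smooth_on U Z -> U z ->
  nabla (fun=> x) (nabla (fun=> y) Z) z - nabla (fun=> y) (nabla (fun=> x) Z) z =
  nabla (fun=> x) (nabla (fun=> y) (fun=> Z z)) z -
  nabla (fun=> y) (nabla (fun=> x) (fun=> Z z)) z.
Proof.
move=> sZ Uz.
have sc (W : normedModType R) (w : W) := smooth_cst w.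
have key (Z' : V -> V) u v : smooth_on U Z' ->
  nabla (fun=> u) (nabla (fun=> v) Z') z = \sum_i
   (pd u (pd v (fun w => l i (Z' w))) z *: e i +
    (pd v (fun w => l i (Z' w)) z *: nabla (fun=> u) (fun=> e i) z +
     pd u (fun w => l i (Z' w)) z *: nabla (fun=> v) (fun=> e i) z +
     l i (Z' z) *: nabla (fun=> u) (nabla (fun=> v) (fun=> e i)) z)).
  move=> sZ'.
  have sl i := smooth_coord i sZ'.
  have H w : U w -> nabla (fun=> v) Z' w =
     \sum_i pd v (fun w => l i (Z' w)) w *: e i +
     \sum_i l i (Z' w) *: nabla (fun=> v) (fun=> e i) w.
    move=> Uw; rewrite -big_split -(@nabla_sum_r _ _ (fun i w => l i (Z' w)) (fun i _ => e i))//.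
    by apply: (connection_ext conn) => // w' _; exact: frame_sum.
  have nabla_r (F G : V -> V) : (forall w, U w -> F w = G w) ->
      nabla (fun=> u) F z = nabla (fun=> u) G z.
    by move=> FG; apply: (connection_ext conn).
  rewrite (nabla_r _ _ H).
  have sN i : smooth_on U (nabla (fun=> v) (fun=> e i)) by apply: smooth_nabla.
  have spd i := smooth_pd v (sl i).
  rewrite nabla_addr//; last 2 first.
  - by apply: smooth_bigsum => i; apply: smooth_scale.
  - by apply: smooth_bigsum => i; apply: smooth_scale.
  rewrite (@nabla_sum_r _ _ (fun i => pd v (fun w => l i (Z' w))) (fun i _ => e i))//.
  rewrite (@nabla_sum_r _ _ (fun i w => l i (Z' w)))//.
  by rewrite -big_split; apply: eq_bigr => i _ /=; rewrite !addrA.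
have pdc u (i : frame_idx E) w : pd u (fun=> l i (Z z)) w = 0.
  by apply: pd_val; exact: is_derive_cst.
have pdc0 u (i : frame_idx E) : pd u (fun=> l i (Z z)) = (fun=> 0).
  by apply/funext => w; exact: pdc.
have pd0c u w : pd u (fun=> 0 : R) w = 0 by apply: pd_val; exact: is_derive_cst.
rewrite !key// -!sumrB; apply: eq_bigr => i _.
rewrite !pdc !pdc0 !pd0c !scale0r !add0r.
rewrite (Ck_pd_comm x y oU _ Uz); last exact: smooth_coord.
rewrite opprD addrACA subrr add0r.
by rewrite [X in X + _ - _]addrC opprD addrACA subrr add0r.
Qed.

Hypothesis torsion_free : forall X Y, smooth_on U X -> smooth_on U Y ->
  forall z, U z -> nabla X Y z - nabla Y X z = lie_bracket X Y z.

(** Torsion-freeness expresses the bracket through [nabla], whose smoothness is an axiom; no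
    derivative in a variable direction has to be examined. *)
Lemma smooth_lie_bracket (X Y : V -> V) : smooth_on U X -> smooth_on U Y ->
  smooth_on U (lie_bracket X Y).
Proof.
move=> sX sY k.
apply: (Ck_ext (f := fun z => nabla X Y z + (-1 : R) *: nabla Y X z)) => //.
  by move=> z Uz; rewrite scaleN1r torsion_free.
apply: Ck_add => //; first exact: smooth_nabla.
by apply: Ck_scale => //; [exact: smooth_cst|exact: smooth_nabla].
Qed.

Lemma curvature_const (X Y Z : V -> V) z :
  smooth_on U X -> smooth_on U Y -> smooth_on U Z -> U z ->
  curvature nabla X Y Z z =
  nabla (fun=> X z) (nabla (fun=> Y z) (fun=> Z z)) z -
  nabla (fun=> Y z) (nabla (fun=> X z) (fun=> Z z)) z.
Proof.
move=> sX sY sZ Uz.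
have sc (v : V) := smooth_cst v.
have sbr := smooth_lie_bracket sX sY.
rewrite /curvature.
rewrite (@nabla_point X (fun=> X z))//; last exact: smooth_nabla.
rewrite (@nabla_point Y (fun=> Y z) (nabla X Z))//; last exact: smooth_nabla.
rewrite (@nabla_point (lie_bracket X Y) (fun=> lie_bracket X Y z))//.
rewrite (@nabla_nabla _ Y)// (@nabla_nabla _ X)//.
have -> : lie_bracket X Y z = pd (X z) Y z - pd (Y z) X z by rewrite -!pdxE.
rewrite nabla_subl// -nabla_nabla_const//.
set A := nabla (fun=> pd _ Y z) Z z; set B := nabla (fun=> pd _ X z) Z z.
by rewrite opprD addrACA [X in X - _]addrC addrK.
Qed.

End Connection.

(** * Calculus of smooth functions and their partial derivatives *)

Section SmoothFunctions.
Variables (R : realType) (V W : normedModType R).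
Implicit Types (U : set V) (f : V -> W).

Lemma smooth_ext U f (g : V -> W) : open U -> (forall x, U x -> f x = g x) ->
  smooth_on U f -> smooth_on U g.
Proof. by move=> oU fg sf k; apply: Ck_ext oU fg _. Qed.

Lemma smooth_sub U U' f : (forall x, U' x -> U x) -> smooth_on U f -> smooth_on U' f.
Proof. by move=> sub sf k; apply: Ck_sub sub _. Qed.

Lemma smooth_add U f (g : V -> W) : open U -> smooth_on U f -> smooth_on U g ->
  smooth_on U (fun x => f x + g x).
Proof. by move=> oU sf sg k; apply: Ck_add. Qed.

Lemma smooth_opp U f : open U -> smooth_on U f -> smooth_on U (fun x => - f x).
Proof.
move=> oU sf; apply: (smooth_ext oU (f := fun x => (-1 : R) *: f x)).
  by move=> x _; rewrite scaleN1r.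
by apply: smooth_scale => //; exact: smooth_cst.
Qed.

Lemma smooth_comm U f u v x : open U -> smooth_on U f -> U x ->
  pd u (pd v f) x = pd v (pd u f) x.
Proof. by move=> oU sf Ux; apply: (Ck_pd_comm u v oU (sf 2%N) Ux). Qed.

Lemma pdB U f (g : V -> W) v x : smooth_on U f -> smooth_on U g -> U x ->
  pd v (fun y => f y - g y) x = pd v f x - pd v g x.
Proof.
by move=> sf sg Ux; apply: pd_val; apply: is_deriveB; apply: (smooth_is_derive (U := U)).
Qed.

Lemma pdA U f (g : V -> W) v x : smooth_on U f -> smooth_on U g -> U x ->
  pd v (fun y => f y + g y) x = pd v f x + pd v g x.
Proof.
by move=> sf sg Ux; apply: pd_val; apply: is_deriveD; apply: (smooth_is_derive (U := U)).
Qed.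

Lemma pd_cst (w : W) v (x : V) : pd v (fun=> w) x = 0.
Proof. by apply: pd_val; exact: is_derive_cst. Qed.

Lemma pd_pd_ext U f (g : V -> W) u v x : open U -> (forall y, U y -> f y = g y) -> U x ->
  pd u (pd v f) x = pd u (pd v g) x.
Proof.
by move=> oU fg Ux; apply: (pd_ext _ oU) => // y Uy; apply: (pd_ext _ oU).
Qed.

Lemma smooth_reverse U f u v w x : open U -> smooth_on U f -> U x ->
  pd u (pd v (pd w f)) x = pd w (pd v (pd u f)) x.
Proof.
move=> oU sf Ux; rewrite (smooth_comm _ _ oU (smooth_pd w sf) Ux).
rewrite (@pd_ext _ _ _ U (pd u (pd w f)) (pd w (pd u f)))//; last first.
  by move=> y Uy; exact: smooth_comm oU sf Uy.
by rewrite (smooth_comm _ _ oU (smooth_pd u sf) Ux).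
Qed.

Lemma pd2_sum (E : frame V) U f (I J : Type) (r : seq I) (s : seq J)
    (a : I -> R) (b : J -> R) (u : I -> V) (v : J -> V) x :
  open U -> smooth_on U f -> U x ->
  pd (\sum_(i <- r) a i *: u i) (pd (\sum_(j <- s) b j *: v j) f) x =
  \sum_(i <- r) \sum_(j <- s) (a i * b j) *: pd (u i) (pd (v j) f) x.
Proof.
move=> oU sf Ux.
have dpd w : differentiable (pd w f) x.
  exact: (Ck_differentiable E oU (smooth_pd w sf 1%N)).
rewrite pd_sumZ//; apply: eq_bigr => i _.
rewrite (@pd_ext _ _ _ U _ (fun y => \sum_(j <- s) b j *: pd (v j) f y))//; last first.
  move=> y Uy; rewrite pd_sumZ//.
  exact: (Ck_differentiable E oU (sf 1%N)).
transitivity (a i *: \sum_(j <- s) b j *: pd (u i) (pd (v j) f) x); last first.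
  by rewrite scaler_sumr; apply: eq_bigr => j _; rewrite scalerA.
congr (_ *: _); apply: pd_val; apply: is_derive_bigsum => j.
by apply: (is_deriveZ (b j)); apply: (smooth_is_derive (U := U)) => //; exact: smooth_pd.
Qed.

(** The index of the innermost derivative is summed outermost, the shape of the contraction in
    [lower_geodesic]. *)
Lemma pd3_sum (E : frame V) U f (I J K : Type) (r : seq I) (s : seq J) (t : seq K)
    (a : I -> R) (b : J -> R) (c : K -> R) (u : I -> V) (v : J -> V) (w : K -> V) x :
  open U -> smooth_on U f -> U x ->
  pd (\sum_(i <- r) a i *: u i) (pd (\sum_(j <- s) b j *: v j)
    (pd (\sum_(k <- t) c k *: w k) f)) x =
  \sum_(k <- t) \sum_(i <- r) \sum_(j <- s)
    (a i * b j * c k) *: pd (u i) (pd (v j) (pd (w k) f)) x.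
Proof.
move=> oU sf Ux.
have sk k : smooth_on U (pd (w k) f) by exact: smooth_pd.
rewrite (@pd2_sum _ U)//; last exact: smooth_pd.
transitivity (\sum_(i <- r) \sum_(j <- s) \sum_(k <- t)
   (a i * b j * c k) *: pd (u i) (pd (v j) (pd (w k) f)) x).
  apply: eq_bigr => i _; apply: eq_bigr => j _.
  rewrite (@pd_pd_ext U _ (fun y => \sum_(k <- t) c k *: pd (w k) f y))//; last first.
    move=> y Uy; rewrite pd_sumZ//.
    exact: (Ck_differentiable E oU (sf 1%N)).
  rewrite (@pd_ext _ _ _ U _ (fun y => \sum_(k <- t) c k *: pd (v j) (pd (w k) f) y))//; last first.
    move=> y Uy; apply: pd_val; apply: is_derive_bigsum => k.
    by apply: (is_deriveZ (c k)); apply: (smooth_is_derive (U := U)).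
  transitivity ((a i * b j) *: \sum_(k <- t) c k *: pd (u i) (pd (v j) (pd (w k) f)) x); last first.
    by rewrite scaler_sumr; apply: eq_bigr => k _; rewrite scalerA.
  congr (_ *: _); apply: pd_val; apply: is_derive_bigsum => k.
  by apply: (is_deriveZ (c k)); apply: (smooth_is_derive (U := U)) => //; exact: smooth_pd.
rewrite [RHS]exchange_big; apply: eq_bigr => i _ /=.
exact: exchange_big.
Qed.

End SmoothFunctions.

Section SmoothMappings.
Variables (R : realType) (V V' W : normedModType R).

Lemma smooth_comp (E : frame V') (U : set V) (U' : set V') (f : V -> V') (g : V' -> W) :
  open U -> open U' -> (forall x, U x -> U' (f x)) ->
  smooth_on U f -> smooth_on U' g -> smooth_on U (fun x => g (f x)).
Proof. by move=> oU oU' fU sf sg k; exact: (Ck_comp E oU oU' fU (sf k) (sg k)). Qed.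

Lemma smooth_pair (U : set V) (f : V -> V') (g : V -> W) :
  open U -> smooth_on U f -> smooth_on U g -> smooth_on U (fun x => (f x, g x)).
Proof. by move=> oU sf sg k; apply: Ck_pair. Qed.

Lemma pd_smooth_comp (E : frame V') (U : set V) (U' : set V') (f : V -> V') (g : V' -> W) x v :
  open U' -> smooth_on U f -> smooth_on U' g -> U x -> U' (f x) ->
  pd v (fun y => g (f y)) x = pd (pd v f x) g (f x).
Proof. by move=> oU' sf sg Ux Ufx; exact: (pd_chain E v oU' (sf 1%N) (sg 1%N) Ux Ufx). Qed.

Lemma pd_fst (G : V * V' -> W) u x y : pd (u, 0) G (x, y) = pd u (fun x => G (x, y)) x.
Proof.
rewrite -!pdxE /derive.
set g1 := fun h : R => h^-1 *: _; set g2 := fun h : R => h^-1 *: _.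
suff -> : g1 = g2 by [].
apply/funext => h; rewrite /g1 /g2 /=.
by congr (_ *: (G _ - _)); congr pair; rewrite /= scaler0 add0r.
Qed.

Lemma pd_snd (G : V * V' -> W) v x y : pd (0, v) G (x, y) = pd v (fun y => G (x, y)) y.
Proof.
rewrite -!pdxE /derive.
set g1 := fun h : R => h^-1 *: _; set g2 := fun h : R => h^-1 *: _.
suff -> : g1 = g2 by [].
apply/funext => h; rewrite /g1 /g2 /=.
by congr (_ *: (G _ - _)); congr pair; rewrite /= scaler0 add0r.
Qed.

Lemma pd_fst2 (G : V * V' -> W) u u' x y :
  pd (u, 0) (pd (u', 0) G) (x, y) = pd u (pd u' (fun x => G (x, y))) x.
Proof.
by rewrite pd_fst; congr (pd _ _ _); apply/funext => x'; rewrite pd_fst.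
Qed.

Lemma pd_snd2 (G : V * V' -> W) v v' x y :
  pd (0, v) (pd (0, v') G) (x, y) = pd v (pd v' (fun y => G (x, y))) y.
Proof.
by rewrite pd_snd; congr (pd _ _ _); apply/funext => y'; rewrite pd_snd.
Qed.

End SmoothMappings.

Lemma smooth_id (R : realType) (V : normedModType R) (U : set V) : smooth_on U id.
Proof. by move=> k; apply: (Ck_linear k U (L := idfun)) => x; exact: cvg_id. Qed.

Lemma smooth_fst (R : realType) (V W : normedModType R) (U : set (V * W)) :
  smooth_on U (fst : V * W -> V).
Proof. by move=> k; apply: Ck_linear; exact: fst_continuous. Qed.

Lemma smooth_snd (R : realType) (V W : normedModType R) (U : set (V * W)) :
  smooth_on U (snd : V * W -> W).
Proof. by move=> k; apply: Ck_linear; exact: snd_continuous. Qed.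

Lemma open_setM (R : realType) (V W : normedModType R) (A : set V) (B : set W) :
  open A -> open B -> open (A `*` B).
Proof.
move=> oA oB; rewrite openE => -[x y] [/= Ax By].
by exists (A, B) => //; split; exact: open_nbhs_nbhs.
Qed.

(** If the derivative [d] were nonzero, a small [h] of sign opposite to [d] would give a quotient of
    sign opposite to [d] or zero, at distance at least the absolute value of [d] from it, against
    convergence. *)
Lemma pd_min_eq0 (R : realType) (V : normedModType R) (f : V -> R) (x v : V) :
  derivable f x v -> (forall y, f x <= f y) -> pd v f x = 0.
Proof.
move=> df fmin; have D := derivable_is_derive df.
apply/eqP; apply: contraT => d0; set d := pd v f x in D d0.
move/is_deriveP : D => /cvgr_dist_lt /(_ `|d|); rewrite normr_gt0 => /(_ d0).
move=> /nbhs_ballP [e /= e0 He].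
pose h := - Num.sg d * (e / 2).
have hn : `|h| = e / 2.
  by rewrite /h normrM normrN normr_sg d0 mul1r gtr0_norm// divr_gt0.
have e2 : 0 < e / 2 by rewrite divr_gt0.
have h0 : h != 0 by rewrite -normr_gt0 hn.
have := He h; rewrite /ball /= sub0r normrN hn ltr_pdivrMr// ltr_pMr// ltr1n => /(_ isT h0).
set k := f _ - f _ => H.
have k0 : 0 <= k by rewrite subr_ge0.
have : `|d| <= `|d - h^-1 *: k|; last by rewrite leNgt H.
have -> : h^-1 *: k = h^-1 * k by [].
case: (ltgtP d 0) => [dn|dp|d00]; last by rewrite d00 eqxx in d0.
  rewrite /h ltr0_sg// opprK mul1r (ltr0_norm dn) -normrN opprB.
  have q0 : 0 <= (e / 2)^-1 * k by rewrite mulr_ge0// invr_ge0 ltW.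
  by rewrite ger0_norm ?lerDr// addr_ge0// oppr_ge0 ltW.
rewrite /h gtr0_sg// mulN1r invrN mulNr opprK (gtr0_norm dp).
have q0 : 0 <= (e / 2)^-1 * k by rewrite mulr_ge0// invr_ge0 ltW.
by rewrite ger0_norm ?lerDl// addr_ge0// ltW.
Qed.

(** The difference quotients are equal as functions, so this covers an [f] not known to be
    derivable. *)
Lemma pd_sub_cst (R : realType) (V W : normedModType R) (f : V -> W) (k : W) (v x : V) :
  pd v (fun y => f y - k) x = pd v f x.
Proof.
rewrite -!pdxE /derive.
set g1 := fun h : R => h^-1 *: _; set g2 := fun h : R => h^-1 *: _.
suff -> : g1 = g2 by [].
by apply/funext => h; rewrite /g1 /g2 /= opprB addrA subrK.
Qed.

Lemma smooth_slice1 (R : realType) (V W : normedModType R) (EV : frame V) (EW : frame W)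
    (UV : set V) (UW : set W) (G : V * W -> R) y :
  open UV -> open UW ->
  smooth_on (UV `*` UW) G -> UW y -> smooth_on UV (fun x => G (x, y)).
Proof.
move=> oV oW sG Uy.
apply: (smooth_comp (frame_prod EV EW) (U' := UV `*` UW)) => //.
  exact: open_setM.
by apply: smooth_pair => //; [exact: smooth_id|exact: smooth_cst].
Qed.

Lemma smooth_slice2 (R : realType) (V W : normedModType R) (EV : frame V) (EW : frame W)
    (UV : set V) (UW : set W) (G : V * W -> R) x :
  open UV -> open UW ->
  smooth_on (UV `*` UW) G -> UV x -> smooth_on UW (fun y => G (x, y)).
Proof.
move=> oV oW sG Uy.
apply: (smooth_comp (frame_prod EV EW) (U' := UV `*` UW)) => //.
  exact: open_setM.
by apply: smooth_pair => //; [exact: smooth_cst|exact: smooth_id].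
Qed.

(** * The Levi-Civita connection of the cost metric *)

Section CostMetric.
Variables (R : realType) (A B : normedModType R) (EA : frame A) (EB : frame B).
Local Notation V := (A * B)%type.
Variables (U : set V) (C : V -> R) (h : V -> V -> V -> R).
Variable (nabla : (V -> V) -> (V -> V) -> V -> V).
Hypotheses (oU : open U) (sC : smooth_on U C).
(** The polarization of [- pd (v.1, 0) (pd (0, v.2) C)] as a quadratic form in [v], whence the
    factor one half. *)
Hypothesis hE : forall z v w, U z -> h z v w =
  - 2^-1 * (pd (v.1, 0) (pd (0, w.2) C) z + pd (w.1, 0) (pd (0, v.2) C) z).
Hypothesis LC : is_levi_civita U h nabla.

Let E : frame V := frame_prod EA EB.
Let N u v := nabla (fun=> u) (fun=> v).
Let conn := levi_civita_connection LC.
Let sc (v : V) : smooth_on U (fun=> v) := smooth_cst U v.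
Let sN u v : smooth_on U (N u v) := smooth_nabla conn (sc u) (sc v).

Let sD v (F : V -> R) : smooth_on U F -> smooth_on U (pd v F).
Proof. exact: smooth_pd. Qed.

Let comm (F : V -> R) u v z : smooth_on U F -> U z ->
  pd u (pd v F) z = pd v (pd u F) z.
Proof. by move=> sF Uz; apply: Ck_pd_comm (sF 2%N) Uz. Qed.

Let pdD (F : V -> R) u v z : smooth_on U F -> U z ->
  pd (u + v) F z = pd u F z + pd v F z.
Proof.
move=> sF Uz; rewrite -[u in LHS]scale1r pd_linear ?scale1r//.
exact: (Ck_differentiable E oU (sF 1%N)).
Qed.

Let pd_ext2 (F G : V -> R) u z : (forall w, U w -> F w = G w) -> U z ->
  pd u F z = pd u G z.
Proof. by move=> FG; apply: pd_ext. Qed.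

Lemma cost_metricC z v w : U z -> h z v w = h z w v.
Proof. by move=> Uz; rewrite !hE// addrC. Qed.

Lemma cost_metricDl z x y w : U z -> h z (x + y) w = h z x w + h z y w.
Proof.
move=> Uz; rewrite !hE// -mulrDr; congr (_ * _); rewrite addrACA; congr (_ + _).
  rewrite -pdD//; last exact: sD.
  by congr pd; rewrite /= [RHS]surjective_pairing /= addr0.
rewrite !(comm (w.1, 0))// -pdD//; last exact: sD.
by congr pd; rewrite /= [RHS]surjective_pairing /= addr0.
Qed.

Lemma cost_metricDr z x y w : U z -> h z w (x + y) = h z w x + h z w y.
Proof. by move=> Uz; rewrite !(cost_metricC w)// cost_metricDl. Qed.

Lemma cost_metric_ll z a a' : U z -> h z (a, 0) (a', 0) = 0.
Proof.
move=> Uz; rewrite hE//=.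
have pd00 : pd ((0, 0) : V) C = fun=> 0 by apply/funext => x; exact: pd0.
rewrite pd00.
have pdc u : pd u (fun=> 0 : R) z = 0 by apply: pd_val; exact: is_derive_cst.
by rewrite !pdc addr0 mulr0.
Qed.

Lemma cost_metric_rr z b b' : U z -> h z (0, b) (0, b') = 0.
Proof. by move=> Uz; rewrite hE//= !pd0 addr0 mulr0. Qed.

Lemma cost_metric_lr z a b : U z ->
  h z (a, 0) (0, b) = - 2^-1 * pd (a, 0) (pd (0, b) C) z.
Proof. by move=> Uz; rewrite hE//= pd0 addr0. Qed.

Lemma cost_metric_rl z a b : U z ->
  h z (0, b) (a, 0) = - 2^-1 * pd (a, 0) (pd (0, b) C) z.
Proof. by move=> Uz; rewrite cost_metricC// cost_metric_lr. Qed.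

Let pdZ (F : V -> R) c u z : smooth_on U F -> U z ->
  pd u (fun w => c * F w) z = c * pd u F z.
Proof.
move=> sF Uz; apply: pd_val.
exact: (is_deriveZ c (smooth_is_derive u sF Uz)).
Qed.

Lemma pd_cost_metric_ll u z a a' : U z ->
  pd u (fun x => h x (a, 0) (a', 0)) z = 0.
Proof.
move=> Uz; rewrite (@pd_ext2 _ (fun=> 0))//; last by move=> w; exact: cost_metric_ll.
by apply: pd_val; exact: is_derive_cst.
Qed.

Lemma pd_cost_metric_rr u z b b' : U z ->
  pd u (fun x => h x (0, b) (0, b')) z = 0.
Proof.
move=> Uz; rewrite (@pd_ext2 _ (fun=> 0))//; last by move=> w; exact: cost_metric_rr.
by apply: pd_val; exact: is_derive_cst.
Qed.

Lemma pd_cost_metric_lr u z a b : U z ->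
  pd u (fun x => h x (a, 0) (0, b)) z =
  - 2^-1 * pd u (pd (a, 0) (pd (0, b) C)) z.
Proof.
move=> Uz.
rewrite (@pd_ext2 _ (fun x => - 2^-1 * pd (a, 0) (pd (0, b) C) x))//.
  by rewrite pdZ//; do 2!apply: sD.
by move=> w; exact: cost_metric_lr.
Qed.

Lemma pd_cost_metric_rl u z a b : U z ->
  pd u (fun x => h x (0, b) (a, 0)) z =
  - 2^-1 * pd u (pd (a, 0) (pd (0, b) C)) z.
Proof.
move=> Uz; rewrite -pd_cost_metric_lr//; apply: pd_ext2 => // w Uw.
exact: cost_metricC.
Qed.

Lemma levi_civita_constC u v z : U z -> N u v z = N v u z.
Proof.
move=> Uz; apply/eqP; rewrite -subr_eq0; apply/eqP.
rewrite (levi_civita_torsion_free LC)// /lie_bracket !pdxE.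
by rewrite !(pd_val (is_derive_cst _ _ _)) subrr.
Qed.

Lemma pd_metric (x : V) (Y Z : V -> V) z : smooth_on U Y -> smooth_on U Z -> U z ->
  pd x (fun w => h w (Y w) (Z w)) z =
    h z (nabla (fun=> x) Y z) (Z z) + h z (Y z) (nabla (fun=> x) Z z).
Proof. by move=> sY sZ Uz; rewrite -(levi_civita_metric LC)// pdxE. Qed.

(** Constant fields commute, so [N] is symmetric and the bracket terms of the general formula are
    absent; expanding the three derivatives by metricity gives the rest. *)
Lemma koszul u v w z : U z ->
  2 * h z (N u v z) w = pd u (fun x => h x v w) z + pd v (fun x => h x u w) z -
    pd w (fun x => h x u v) z.
Proof.
move=> Uz; rewrite !(@pd_metric _ (fun=> _) (fun=> _))// -!/(N _ _ _).
rewrite (levi_civita_constC v u)// (levi_civita_constC w u)// (levi_civita_constC w v)//.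
rewrite (cost_metricC v)// (cost_metricC u (N v w z))//.
by ring.
Qed.

(** The coefficients of [h] are mixed derivatives of [C]. Against either factor, the two surviving
    Koszul terms are therefore one third derivative of [C] taken with opposite signs. *)
Lemma koszul_lr a b v z : U z -> h z (N (a, 0) (0, b) z) v = 0.
Proof.
move=> Uz.
have -> : v = (v.1, 0) + (0, v.2).
  by rewrite [LHS]surjective_pairing; congr pair; rewrite /= ?addr0 ?add0r.
have two (x : R) : 2 * x = 0 -> x = 0.
  by move/eqP; rewrite mulf_eq0 pnatr_eq0 /= => /eqP.
rewrite cost_metricDr// [X in X + _]two ?[X in _ + X]two ?addr0//.
  rewrite koszul// pd_cost_metric_rr// !pd_cost_metric_lr// add0r.
  by rewrite (smooth_reverse (0, b) (a, 0) _ oU sC Uz) subrr.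
rewrite koszul// pd_cost_metric_ll// pd_cost_metric_rl// pd_cost_metric_lr// addr0.
by rewrite (comm (v.1, 0))// ?subrr//; exact: sD.
Qed.

Lemma koszul_rr_r b b' z : U z -> h z (N (0, b) (0, b) z) (0, b') = 0.
Proof.
move=> Uz.
have two (x : R) : 2 * x = 0 -> x = 0.
  by move/eqP; rewrite mulf_eq0 pnatr_eq0 /= => /eqP.
by apply: two; rewrite koszul// !pd_cost_metric_rr// addr0 subr0.
Qed.

Lemma koszul_rr_l b a z : U z -> h z (N (0, b) (0, b) z) (a, 0) =
  - 2^-1 * pd (a, 0) (pd (0, b) (pd (0, b) C)) z.
Proof.
move=> Uz.
have two (x y : R) : 2 * x = 2 * y -> x = y.
  by move/mulfI; apply; rewrite pnatr_eq0.
apply: two; rewrite koszul// pd_cost_metric_rr// !pd_cost_metric_rl// subr0.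
rewrite (comm (0, b) (a, 0))//; last exact: sD.
by rewrite -mulrDr; ring.
Qed.

(** Here [q] stands for the acceleration of the dual curve, known only through the last hypothesis.
    It replaces [nabla_b b] by [- (0, q)] inside [h]-products. *)
Lemma sec_u_cost (X Y : V -> V) (a : A) (b q : B) z :
  smooth_on U X -> smooth_on U Y -> U z -> X z = (a, 0) -> Y z = (0, b) ->
  (forall u, pd (u, 0) (pd (0, b) (pd (0, b) C)) z +
             pd (u, 0) (pd (0, q) C) z = 0) ->
  - 2 * sec_u h nabla X Y z =
    pd (a, 0) (pd (a, 0) (pd (0, b) (pd (0, b) C))) z +
    pd (0, q) (pd (a, 0) (pd (a, 0) C)) z.
Proof.
move=> sX sY Uz Xz Yz dual.
have torsion := levi_civita_torsion_free LC.
rewrite /sec_u (curvature_const E oU conn torsion)// Xz Yz -!/(N _ _).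
pose a0 : V := (a, 0); pose b0 : V := (0, b); pose q0 : V := (0, q).
rewrite -/a0 -/b0 -/q0.
set RA := nabla (fun=> a0) (N b0 b0) z; set RB := nabla (fun=> b0) (N a0 b0) z.
(* Differentiate the vanishing function [h (nabla_a b, a)] along [b]: by metricity [RB] meets [a],
   and the other product contains [nabla_a b] again. *)
have RB0 : h z RB a0 = 0.
  have := pd_metric b0 (sN a0 b0) (sc a0) Uz; rewrite -/RB.
  rewrite (@pd_ext2 _ (fun=> 0)) => [|w Uw|//]; last exact: koszul_lr.
  by rewrite (pd_val (is_derive_cst _ _ _)) koszul_lr// addr0 => <-.
have hRA : h z RA a0 = - 2^-1 * pd a0 (pd a0 (pd b0 (pd b0 C))) z - h z (N b0 b0 z) (N a0 a0 z).
  have := pd_metric a0 (sN b0 b0) (sc a0) Uz; rewrite -/RA -/(N a0 a0).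
  rewrite (@pd_ext2 _ (fun w => - 2^-1 * pd a0 (pd b0 (pd b0 C)) w)) => [|w Uw|//]; last exact: koszul_rr_l.
  by rewrite pdZ//; [move=> ->; rewrite addrK|do 3!apply: sD].
(* The sum of [N b0 b0 z] and [q0] is orthogonal to the first factor by [dual] and to the second
   because both summands are. *)
have hRR : h z (N b0 b0 z) (N a0 a0 z) = - h z q0 (N a0 a0 z).
  apply/eqP; rewrite -addr_eq0 -cost_metricDl//; apply/eqP.
  set v := N a0 a0 z.
  have -> : v = (v.1, 0) + (0, v.2).
    by rewrite [LHS]surjective_pairing; congr pair; rewrite /= ?addr0 ?add0r.
  rewrite cost_metricDr// !cost_metricDl// koszul_rr_l// koszul_rr_r//.
  by rewrite cost_metric_rl// cost_metric_rr// -mulrDr dual mulr0 !addr0.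
have hq : h z q0 (N a0 a0 z) = - 2^-1 * pd q0 (pd a0 (pd a0 C)) z.
  rewrite cost_metricC//.
  have two (x y : R) : 2 * x = 2 * y -> x = y.
    by move/mulfI; apply; rewrite pnatr_eq0.
  apply: two; rewrite koszul// pd_cost_metric_ll// !pd_cost_metric_lr// subr0.
  rewrite (comm q0)//; last exact: sD.
  rewrite (@pd_ext2 (pd q0 (pd a0 C)) (pd a0 (pd q0 C)) a0)//.
    by rewrite -mulrDr; ring.
  by move=> w Uw; exact: comm.
have hB z' x y w : U z' -> h z' (x - y) w = h z' x w - h z' y w.
  move=> Uz'; apply/eqP; rewrite eq_sym subr_eq -cost_metricDl//.
  by rewrite subrK.
rewrite hB// RB0 hRA hRR hq.
by field.
Qed.

End CostMetric.

(** * The divergence in charts *)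

Section LocalDivergence.
Variables (R : realType) (A B : normedModType R) (EA : frame A) (EB : frame B).
Variables (O U1 : set A) (U2 : set B) (C : A * B -> R) (F : A -> B).
Variables (phi kappa : A -> R) (L : A * A -> R).
Hypotheses (oO : open O) (oU1 : open U1) (oU2 : open U2).
Hypotheses (OU1 : forall x, O x -> U1 x) (FU2 : forall x, O x -> U2 (F x)).
Hypotheses (sC : smooth_on (U1 `*` U2) C) (sF : smooth_on O F).
Hypotheses (sphi : smooth_on O phi) (skappa : smooth_on O kappa).
Hypothesis LE : forall x y, O x -> O y -> L (x, y) = C (x, F y) - phi x - kappa y.

Let oU : open (U1 `*` U2). Proof. exact: open_setM. Qed.
Let oOO : open (O `*` O). Proof. exact: open_setM. Qed.

Lemma smooth_divergence : smooth_on (O `*` O) L.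
Proof.
have s1 : smooth_on (O `*` O) (fun z => F z.2).
  apply: (smooth_comp EA (U' := O) (f := snd)) => //; first by move=> z [].
  exact: smooth_snd.
have s2 : smooth_on (O `*` O) (fun z => C (z.1, F z.2)).
  apply: (smooth_comp (frame_prod EA EB) (U' := U1 `*` U2)) => //.
    by move=> z [/= Oz1 Oz2]; split; [exact: OU1|exact: FU2].
  by apply: smooth_pair => //; exact: smooth_fst.
have s3 : smooth_on (O `*` O) (fun z => - phi z.1).
  apply: smooth_opp => //.
  apply: (smooth_comp EA (U' := O) (f := fst)) => //; first by move=> z [].
  exact: smooth_fst.
have s4 : smooth_on (O `*` O) (fun z => - kappa z.2).
  apply: smooth_opp => //.
  apply: (smooth_comp EA (U' := O) (f := snd)) => //; first by move=> z [].
  exact: smooth_snd.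
apply: (smooth_ext oOO (f := fun z => C (z.1, F z.2) + - phi z.1 + - kappa z.2)).
  by move=> -[x y] [/= Ox Oy]; rewrite LE.
by apply: smooth_add => //; exact: smooth_add.
Qed.

Let sL := smooth_divergence.

Lemma divergence_pd1 u x y : O x -> O y ->
  pd (u, 0) L (x, y) = pd (u, 0) C (x, F y) - pd u phi x.
Proof.
move=> Ox Oy; rewrite !pd_fst.
have s1 : smooth_on O (fun x => C (x, F y)).
  apply: (smooth_sub OU1); apply: (smooth_slice1 EA EB oU1 oU2 sC).
  exact: FU2.
rewrite (@pd_ext _ _ _ O _ (fun x => C (x, F y) - (phi x + kappa y)))//; last first.
  by move=> z Oz; rewrite LE// opprD addrA.
rewrite (pdB (U := O))//; last by apply: smooth_add => //; exact: smooth_cst.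
rewrite (pdA (U := O))//; last exact: smooth_cst.
by rewrite pd_cst addr0.
Qed.

Lemma divergence_pd2 v x y : O x -> O y ->
  pd (0, v) L (x, y) = pd (0, pd v F y) C (x, F y) - pd v kappa y.
Proof.
move=> Ox Oy; rewrite !pd_snd.
have s1 : smooth_on U2 (fun y => C (x, y)).
  by apply: (smooth_slice2 EA EB oU1 oU2 sC); exact: OU1.
have s2 : smooth_on O (fun y => C (x, F y)) by exact: (smooth_comp EB oO oU2 FU2 sF s1).
rewrite (@pd_ext _ _ _ O _ (fun y => C (x, F y) - phi x - kappa y))//; last first.
  by move=> z Oz; rewrite LE.
rewrite (pdB (U := O))//; last first.
  by apply: smooth_add => //; exact: smooth_cst.
rewrite (pdB (U := O))//; last exact: smooth_cst.
rewrite pd_cst subr0; congr (_ - _).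
by rewrite (pd_smooth_comp EB v oU2 sF s1)//; exact: FU2.
Qed.

(** Each of the potentials [phi] and [kappa] depends on one variable, so a mixed derivative removes
    both; the second direction is pushed forward by [F]. *)
Lemma divergence_pd12 u v x y : O x -> O y ->
  pd (u, 0) (pd (0, v) L) (x, y) = pd (u, 0) (pd (0, pd v F y) C) (x, F y).
Proof.
move=> Ox Oy; rewrite !pd_fst.
have s1 : smooth_on O (fun x => pd (0, pd v F y) C (x, F y)).
  apply: (smooth_sub OU1); apply: (smooth_slice1 EA EB oU1 oU2) => //.
    exact: smooth_pd.
  exact: FU2.
rewrite (@pd_ext _ _ _ O _ (fun x => pd (0, pd v F y) C (x, F y) - pd v kappa y))//; last first.
  by move=> z Oz; rewrite divergence_pd2.
by rewrite (pdB (U := O))// ?pd_cst ?subr0//; exact: smooth_cst.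
Qed.

Lemma divergence_pd112 u u' v x y : O x -> O y ->
  pd (u, 0) (pd (u', 0) (pd (0, v) L)) (x, y) =
  pd (u, 0) (pd (u', 0) (pd (0, pd v F y) C)) (x, F y).
Proof.
move=> Ox Oy; rewrite !pd_fst; apply: (pd_ext _ oO) => // z Oz.
exact: divergence_pd12.
Qed.

Hypotheses (L_ge0 : forall x y, O y -> 0 <= L (x, y)).
Hypotheses (L_diag : forall x, O x -> L (x, x) = 0).

(** With the second argument fixed at [x], the divergence has its minimum 0 at [x]. *)
Lemma divergence_pd1_diag u x : O x -> pd (u, 0) L (x, x) = 0.
Proof.
move=> Ox; rewrite pd_fst; apply: pd_min_eq0.
  have s1 : smooth_on O (fun x' => L (x', x)) by apply: (smooth_slice1 EA EA oO oO sL).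
  by have [] := smooth_is_derive u s1 Ox.
by move=> y; rewrite L_diag//; exact: L_ge0.
Qed.

(* Differentiate [pd (u, 0) L = 0] along the diagonal. *)
Lemma divergence_sym u v x : O x ->
  pd (u, 0) (pd (0, v) L) (x, x) = pd (v, 0) (pd (0, u) L) (x, x).
Proof.
have key u' v' y : O y ->
    pd (v', 0) (pd (u', 0) L) (y, y) + pd (0, v') (pd (u', 0) L) (y, y) = 0.
  move=> Oy.
  have sd : smooth_on O (fun x : A => (x, x)) by apply: smooth_pair => //; exact: smooth_id.
  have sL1 : smooth_on (O `*` O) (pd (u', 0) L) by exact: smooth_pd.
  have := pd_smooth_comp (frame_prod EA EA) v' oOO sd sL1 Oy.
  rewrite (@pd_ext _ _ _ O _ (fun=> 0))//; last by move=> z Oz; exact: divergence_pd1_diag.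
  rewrite pd_cst => /(_ (conj Oy Oy)) ->.
  have -> : pd v' (fun x => (x, x)) y = (v', 0) + (0, v').
    have -> : ((v', 0) + (0, v') : A * A) = (v', v').
      by congr pair; rewrite /= ?addr0 ?add0r.
    by apply: pd_val; apply: is_derive_pair; exact: is_derive_id.
  rewrite -[(v', 0) in RHS]scale1r pd_linear ?scale1r//.
  exact: (Ck_differentiable (frame_prod EA EA) oOO (sL1 1%N)).
move=> Ox; have Oxx : (O `*` O) (x, x) by split.
rewrite (smooth_comm _ _ oOO sL Oxx).
have /eqP := key u v x Ox; rewrite addrC addr_eq0 => /eqP ->.
rewrite (smooth_comm (v, 0) (u, 0) oOO sL Oxx).
have /eqP := key v u x Ox; rewrite addr_eq0 => /eqP ->.
by rewrite opprK (smooth_comm _ _ oOO sL Oxx).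
Qed.

(** This transfers the dual equation from the coordinates [S] of [M] to the curve [Q] in [M']. The
    potential [phi] contributes only a constant to [pd (w, 0) L] in its second argument. *)
Lemma divergence_dual (J : set R) (S : R -> A) t w :
  open J -> J t -> (forall r, J r -> O (S r)) -> smooth_on J S ->
  let s1 := pd (1 : R) S t in let s2 := pd (1 : R) (pd (1 : R) S) t in
  let Q := fun r => F (S r) in
  let b := pd (1 : R) Q t in let q := pd (1 : R) (pd (1 : R) Q) t in
  let z := (S t, F (S t)) in
  pd (0, s2) (pd (w, 0) L) (S t, S t) +
    pd (0, s1) (pd (0, s1) (pd (w, 0) L)) (S t, S t) = 0 ->
  pd (w, 0) (pd (0, b) (pd (0, b) C)) z + pd (w, 0) (pd (0, q) C) z = 0.
Proof.
move=> oJ Jt SO sS s1 s2 Q b q z.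
have OS := SO t Jt.
have U1S : U1 (S t) by exact: OU1.
have Uz : (U1 `*` U2) z by split => //; exact: FU2.
pose D (y : B) := pd (w, 0) C (S t, y).
have sD : smooth_on U2 D.
  by apply: (smooth_slice2 EA EB oU1 oU2) => //; exact: smooth_pd.
pose K (y : A) := D (F y).
have sK : smooth_on O K by exact: (smooth_comp EB oO oU2 FU2 sF sD).
have LK y : O y -> pd (w, 0) L (S t, y) = K y - pd w phi (S t).
  by move=> Oy; rewrite divergence_pd1.
have E1 v y : O y -> pd (0, v) (pd (w, 0) L) (S t, y) = pd v K y.
  move=> Oy; rewrite pd_snd (@pd_ext _ _ _ O _ (fun y => K y - pd w phi (S t)))//.
  by rewrite (pdB (U := O))// ?pd_cst ?subr0//; exact: smooth_cst.
have E2 v v' : pd (0, v) (pd (0, v') (pd (w, 0) L)) (S t, S t) = pd v (pd v' K) (S t).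
  by rewrite pd_snd; apply: (pd_ext _ oO) => // y; exact: E1.
(* The function [D (F (S r))] has one second derivative at [t]: read as [K \o S] it is the left side
   of the given equation, read as [D \o Q] it yields [b] and [q]. *)
rewrite E1// E2 -(pd_pd_comp EA (1 : R) oJ oO SO (sS 2%N) (sK 2%N) Jt).
have QU2 r : J r -> U2 (Q r) by move=> Jr; apply: FU2; exact: SO.
have sQ : smooth_on J Q by exact: (smooth_comp EA oJ oO SO sS sF).
rewrite -[K \o S]/(D \o Q) (pd_pd_comp EB (1 : R) oJ oU2 QU2 (sQ 2%N) (sD 2%N) Jt).
rewrite -/b -/q -!pd_snd -/D.
have -> : pd (0, q) (pd (w, 0) C) (S t, Q t) = pd (w, 0) (pd (0, q) C) z.
  exact: (smooth_comm _ _ oU sC Uz).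
rewrite /D -pd_snd2 -[(S t, Q t)]/z (smooth_reverse (0, b) (0, b) _ oU sC Uz).
by rewrite addrC.
Qed.

End LocalDivergence.

(** * Geodesics in coordinates *)

Section Coordinates.
Variables (R : realType) (n : nat).
Local Notation E := 'rV[R]_n.
Local Notation V := (E * E)%type.

Lemma partial1E (i : 'I_n) (F : V -> R) : partial1 i F = pd (delta_mx 0 i, 0) F.
Proof. by rewrite /partial1 pdE. Qed.

Lemma partial2E (i : 'I_n) (F : V -> R) : partial2 i F = pd (0, delta_mx 0 i) F.
Proof. by rewrite /partial2 pdE. Qed.

Lemma row_pair1 (a : E) : (a, 0) = \sum_i a 0 i *: (delta_mx 0 i, 0) :> V.
Proof.
rewrite [RHS]surjective_pairing; congr pair; rewrite raddf_sum /=.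
  exact: row_sum_delta.
by rewrite big1// => i _; exact: scaler0.
Qed.

Lemma row_pair2 (a : E) : (0, a) = \sum_i a 0 i *: (0, delta_mx 0 i) :> V.
Proof.
rewrite [RHS]surjective_pairing; congr pair; rewrite raddf_sum /=.
  by rewrite big1// => i _; exact: scaler0.
exact: row_sum_delta.
Qed.

Let EV : frame V := frame_prod (frame_row R n) (frame_row R n).

Section Expansion.
Variables (U : set V) (F : V -> R).
Hypotheses (oU : open U) (sF : smooth_on U F).

Lemma pd12_expand a b z : U z ->
  pd (a, 0) (pd (0, b) F) z =
  \sum_i \sum_j a 0 i * b 0 j * partial1 i (partial2 j F) z.
Proof.
move=> Uz; rewrite row_pair1 (row_pair2 b) (pd2_sum EV _ _ _ _ _ _ oU sF Uz).
by apply: eq_bigr => i _; apply: eq_bigr => j _; rewrite partial1E partial2E.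
Qed.

Lemma pd112_expand a a' b z : U z ->
  pd (a, 0) (pd (a', 0) (pd (0, b) F)) z =
  \sum_k \sum_i \sum_j a 0 i * a' 0 j * b 0 k *
    partial1 i (partial1 j (partial2 k F)) z.
Proof.
move=> Uz; rewrite (row_pair1 a) (row_pair1 a') (row_pair2 b).
rewrite (pd3_sum EV _ _ _ _ _ _ _ _ _ oU sF Uz).
apply: eq_bigr => k _; apply: eq_bigr => i _; apply: eq_bigr => j _.
by rewrite !partial1E partial2E.
Qed.

Lemma pd221_expand a a' b z : U z ->
  pd (0, a) (pd (0, a') (pd (b, 0) F)) z =
  \sum_k \sum_i \sum_j a 0 i * a' 0 j * b 0 k *
    partial2 i (partial2 j (partial1 k F)) z.
Proof.
move=> Uz; rewrite (row_pair2 a) (row_pair2 a') (row_pair1 b).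
rewrite (pd3_sum EV _ _ _ _ _ _ _ _ _ oU sF Uz).
apply: eq_bigr => k _; apply: eq_bigr => i _; apply: eq_bigr => j _.
by rewrite !partial2E partial1E.
Qed.

End Expansion.

(** In row form the equation is [a2 = - (T *m invmx g)], that is [a2 *m g = - T]; pairing with [w]
    removes the inverse matrix. *)
Lemma lower_geodesic (g : 'M[R]_n) (G : 'I_n -> 'I_n -> 'I_n -> R) (a2 a w : E) :
  g \in unitmx ->
  (forall k, a2 0 k + \sum_i \sum_j (\sum_m G i j m * invmx g m k) * a 0 i * a 0 j = 0) ->
  \sum_k \sum_l a2 0 k * w 0 l * g k l +
  \sum_l \sum_i \sum_j a 0 i * a 0 j * w 0 l * G i j l = 0.
Proof.
move=> ug geo.
pose T : E := \row_m \sum_i \sum_j G i j m * a 0 i * a 0 j.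
have a2E : a2 = - (T *m invmx g).
  apply/rowP => k; have /eqP := geo k; rewrite addr_eq0 => /eqP ->.
  rewrite !mxE; congr (- _).
  transitivity (\sum_i \sum_m \sum_j G i j m * invmx g m k * a 0 i * a 0 j).
    apply: eq_bigr => i _; rewrite exchange_big; apply: eq_bigr => j _ /=.
    by rewrite !mulr_suml.
  rewrite exchange_big; apply: eq_bigr => m _; rewrite mxE mulr_suml.
  apply: eq_bigr => i _; rewrite mulr_suml; apply: eq_bigr => j _.
  by ring.
have a2g : a2 *m g = - T by rewrite a2E mulNmx mulmxKV.
have -> : \sum_k \sum_l a2 0 k * w 0 l * g k l = \sum_l w 0 l * (a2 *m g) 0 l.
  rewrite exchange_big; apply: eq_bigr => l _; rewrite mxE mulr_sumr.
  by apply: eq_bigr => k _; ring.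
rewrite a2g -big_split big1// => l _; rewrite !mxE /=.
rewrite mulrN addrC; apply/eqP; rewrite subr_eq0; apply/eqP.
rewrite mulr_sumr; apply: eq_bigr => i _; rewrite mulr_sumr; apply: eq_bigr => j _.
by ring.
Qed.

Section Divergence.
Variables (O : set E) (L : V -> R) (x : E).
Hypotheses (oO : open O) (sL : smooth_on (O `*` O) L) (Ox : O x).

Let oOO : open (O `*` O). Proof. exact: open_setM. Qed.
Let Oxx : (O `*` O) (x, x). Proof. by []. Qed.

Let g : 'M[R]_n := \matrix_(i, j) - partial1 i (partial2 j L) (x, x).

Lemma primal_contract (a2 a w : E) : g \in unitmx ->
  (forall k, a2 0 k + \sum_i \sum_j
    (\sum_m - partial1 i (partial1 j (partial2 m L)) (x, x) * invmx g m k) *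
      a 0 i * a 0 j = 0) ->
  pd (a2, 0) (pd (0, w) L) (x, x) + pd (a, 0) (pd (a, 0) (pd (0, w) L)) (x, x) = 0.
Proof.
move=> ug /(lower_geodesic w ug) H.
rewrite (pd12_expand oOO sL)// (pd112_expand oOO sL)//.
apply: oppr_inj; rewrite oppr0 -[RHS]H opprD; congr (_ + _).
  rewrite -sumrN; apply: eq_bigr => k _; rewrite -sumrN; apply: eq_bigr => l _.
  by rewrite !mxE mulrN.
rewrite -sumrN; apply: eq_bigr => k _; rewrite -sumrN; apply: eq_bigr => i _.
by rewrite -sumrN; apply: eq_bigr => j _; rewrite mulrN.
Qed.

Hypothesis L_sym : forall u v,
  pd (u, 0) (pd (0, v) L) (x, x) = pd (v, 0) (pd (0, u) L) (x, x).

(** Lowering the index puts [a2] in the first slot of the mixed Hessian, whereas the dual equation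
    needs it in the second; [L_sym] exchanges them. *)
Lemma dual_contract (a2 a w : E) : g \in unitmx ->
  (forall k, a2 0 k + \sum_i \sum_j
    (\sum_m - partial2 i (partial2 j (partial1 m L)) (x, x) * invmx g m k) *
      a 0 i * a 0 j = 0) ->
  pd (0, a2) (pd (w, 0) L) (x, x) + pd (0, a) (pd (0, a) (pd (w, 0) L)) (x, x) = 0.
Proof.
move=> ug /(lower_geodesic w ug) H.
rewrite (smooth_comm _ _ oOO sL)// L_sym (pd12_expand oOO sL)// (pd221_expand oOO sL)//.
apply: oppr_inj; rewrite oppr0 -[RHS]H opprD; congr (_ + _).
  rewrite -sumrN; apply: eq_bigr => k _; rewrite -sumrN; apply: eq_bigr => l _.
  by rewrite !mxE mulrN.
rewrite -sumrN; apply: eq_bigr => k _; rewrite -sumrN; apply: eq_bigr => i _.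
by rewrite -sumrN; apply: eq_bigr => j _; rewrite mulrN.
Qed.

End Divergence.

End Coordinates.

(** * The cost metric and curves in coordinates *)

Section MetricH.
Variables (R : realType) (n : nat) (M M' : manifold R n) (c : M -> M' -> R).
Variables (chi : chart R n M) (chi' : chart R n M').
Let U := chart_cod chi `*` chart_cod chi'.
Hypothesis sC : smooth_on U (local_cost c chi chi').

Lemma open_chart_cod2 : open U.
Proof. by apply: open_setM; exact: cod_open. Qed.

Lemma quad_hE z v : U z ->
  quad_h c chi chi' z v = - pd (v.1, 0) (pd (0, v.2) (local_cost c chi chi')) z.
Proof.
move=> Uz; rewrite /quad_h (pd12_expand open_chart_cod2 sC)//; congr (- _).
by apply: eq_bigr => i _; apply: eq_bigr => j _; rewrite mxE; ring.
Qed.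

Lemma metric_hE z v w : U z -> metric_h c chi chi' z v w =
  - 2^-1 * (pd (v.1, 0) (pd (0, w.2) (local_cost c chi chi')) z +
            pd (w.1, 0) (pd (0, v.2) (local_cost c chi chi')) z).
Proof.
move=> Uz; rewrite /metric_h !quad_hE//.
rewrite !(pd12_expand open_chart_cod2 sC)//.
set b := fun v w : 'rV[R]_n => \sum_i \sum_j v 0 i * w 0 j * partial1 i (partial2 j (local_cost c chi chi')) z.
have bl x y u : b (x + y) u = b x u + b y u.
  rewrite /b -big_split; apply: eq_bigr => i _; rewrite -big_split; apply: eq_bigr => j _ /=.
  by rewrite !mxE; ring.
have br x y u : b u (x + y) = b u x + b u y.
  rewrite /b -big_split; apply: eq_bigr => i _; rewrite -big_split; apply: eq_bigr => j _ /=.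
  by rewrite !mxE; ring.
rewrite -!/(b _ _) /= bl !br.
by field.
Qed.

End MetricH.

Lemma open_preimage_on (T T' : topologicalType) (U : set T) (f : T -> T')
    (V : set T') : open U -> (forall x, U x -> {for x, continuous f}) ->
  open V -> open (U `&` f @^-1` V).
Proof.
move=> oU cf oV; rewrite openE => x [Ux Vfx].
apply: filterI; first exact: open_nbhs_nbhs.
by apply: cf => //; exact: open_nbhs_nbhs.
Qed.

Lemma derive1n2E (R : realType) (V : normedModType R) (f : R -> V) :
  derive1n 2 f = pd (1 : R) (pd (1 : R) f).
Proof.
have d1 (g : R -> V) : derive1 g = pd (1 : R) g.
  by apply/funext => t; rewrite derive1E pdxE.
by rewrite /derive1n /= !d1.
Qed.

Section CurveCoordinates.
Variables (R : realType) (n : nat) (I : set R) (P : R -> 'rV[R]_n).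
Hypotheses (oI : open I) (sP : smooth_on I P).

Lemma pd_row_coord k t : I t ->
  pd (1 : R) (fun r => P r 0 k) t = pd (1 : R) P t 0 k.
Proof.
move=> It; apply: pd_val.
have c_ : continuous (row_coord k : {linear 'rV[R]_n -> R}) by exact: coord_continuous.
exact: (is_derive_linear c_ (smooth_is_derive (1 : R) sP It)).
Qed.

Lemma pd_pd_row_coord k t : I t ->
  pd (1 : R) (pd (1 : R) (fun r => P r 0 k)) t = pd (1 : R) (pd (1 : R) P) t 0 k.
Proof.
move=> It.
rewrite (@pd_ext _ _ _ I _ (fun r => pd (1 : R) P r 0 k))//; last first.
  by move=> r; exact: pd_row_coord.
apply: pd_val.
have c_ : continuous (row_coord k : {linear 'rV[R]_n -> R}) by exact: coord_continuous.
exact: (is_derive_linear c_ (smooth_is_derive (1 : R) (smooth_pd (1 : R) sP) It)).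
Qed.

End CurveCoordinates.

(** * Fourth derivative of the cost along two curves *)

Section MixedFourthDerivative.
Variables (R : realType) (A B : normedModType R) (EA : frame A) (EB : frame B).
Variables (U1 : set A) (U2 : set B) (C : A * B -> R).
Hypotheses (oU1 : open U1) (oU2 : open U2) (sC : smooth_on (U1 `*` U2) C).
Variables (I J : set R) (P : R -> A) (Q : R -> B).
Hypotheses (oI : open I) (oJ : open J) (sP : smooth_on I P) (sQ : smooth_on J Q).
Hypotheses (PU : forall s, I s -> U1 (P s)) (QU : forall t, J t -> U2 (Q t)).

Let D (V : normedModType R) : (R -> V) -> R -> V := pd (1 : R).

(** The inner second derivative is [H (P s)] with [H] a function of the first argument alone, so the
    second-order chain rule is applied once in each factor. *)
Lemma mixed_fourth_derivative s0 t0 : I s0 -> J t0 ->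
  let a := D P s0 in let a2 := D (D P) s0 in
  let b := D Q t0 in let q := D (D Q) t0 in let z := (P s0, Q t0) in
  D (D (fun s => D (D (fun t => C (P s, Q t))) t0)) s0 =
  pd (a2, 0) (pd (0, q) C) z + pd (a2, 0) (pd (0, b) (pd (0, b) C)) z +
  (pd (a, 0) (pd (a, 0) (pd (0, q) C)) z +
   pd (a, 0) (pd (a, 0) (pd (0, b) (pd (0, b) C))) z).
Proof.
move=> Is Jt a a2 b q z.
have oU : open (U1 `*` U2) by exact: open_setM.
pose G w := pd (0, q) C w + pd (0, b) (pd (0, b) C) w.
have sq : smooth_on (U1 `*` U2) (pd (0, q) C) by exact: smooth_pd.
have sb : smooth_on (U1 `*` U2) (pd (0, b) (pd (0, b) C)).
  by apply: smooth_pd; exact: smooth_pd.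
have sG : smooth_on (U1 `*` U2) G by exact: smooth_add.
pose H x := G (x, Q t0).
have sH : smooth_on U1 H by apply: (smooth_slice1 EA EB oU1 oU2 sG); exact: QU.
have inner s : I s -> D (D (fun t => C (P s, Q t))) t0 = (H \o P) s.
  move=> Is'.
  have sl : smooth_on U2 (fun y => C (P s, y)).
    by apply: (smooth_slice2 EA EB oU1 oU2 sC); exact: PU.
  rewrite [LHS](pd_pd_comp EB (1 : R) oJ oU2 QU (sQ 2%N) (sl 2%N) Jt).
  by rewrite /= /H /G pd_snd2 pd_snd.
rewrite [LHS](pd_pd_ext _ _ oI inner Is).
rewrite (pd_pd_comp EA (1 : R) oI oU1 PU (sP 2%N) (sH 2%N) Is).
rewrite /H -pd_fst -pd_fst2 -/a -/a2.
have Uz : (U1 `*` U2) z by split; [exact: PU|exact: QU].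
have GA u w : (U1 `*` U2) w -> pd u G w = pd u (pd (0, q) C) w + pd u (pd (0, b) (pd (0, b) C)) w.
  by move=> Uw; rewrite (pdA (U := U1 `*` U2)).
rewrite -[(P s0, Q t0)]/z GA//; congr (_ + _).
rewrite (@pd_ext _ _ _ (U1 `*` U2) _ _ (a, 0) z oU (GA (a, 0)) Uz).
by rewrite (pdA (U := U1 `*` U2))//; exact: smooth_pd.
Qed.

End MixedFourthDerivative.

(** * The divergence and the transport map in charts *)

Section CTransform.
Variables (R : realType) (n : nat) (M M' : manifold R n).
Variables (c : M -> M' -> R) (phi : M -> R) (f : M -> M').
Hypothesis f_c_gradient : is_c_gradient c phi f.

Lemma c_transform_gradient p : c_transform c phi (f p) = (c p (f p) - phi p)%:E.
Proof.
have := (f_c_gradient p (f p)).2 erefl.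
(* An infinite value is excluded, because its sum with [phi p] would not be the finite cost. *)
by case: (c_transform _ _ _) => [r [<-]|//|//]; rewrite addrAC subrr add0r.
Qed.

Lemma c_divergence_graph p p' :
  c_divergence c phi (p, f p) (p', f p') =
  c p (f p') - phi p - (c p' (f p') - phi p').
Proof. by rewrite /c_divergence /= c_transform_gradient. Qed.

Lemma c_divergence_ge0 p p' : 0 <= c_divergence c phi (p, f p) (p', f p').
Proof.
rewrite c_divergence_graph subr_ge0 -lee_fin -c_transform_gradient.
by apply: ereal_inf_lbound; exists p.
Qed.

End CTransform.

Section LocalTransport.
Variables (R : realType) (n : nat) (M M' : manifold R n).
Variables (c : M -> M' -> R) (phi : M -> R) (f : M -> M').
Hypotheses (c_smooth : smooth_cost c) (c_nondegenerate : nondegenerate_cost c).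
Hypotheses (phi_smooth : smooth_fun phi) (f_c_gradient : is_c_gradient c phi f).
Hypothesis f_diffeo : diffeo_onto_range f.
Variables (chi : chart R n M) (chi' : chart R n M').
Hypotheses (chi_atlas : atlas chi) (chi'_atlas : atlas chi').

Local Notation E := 'rV[R]_n.
Local Notation U1 := (chart_cod chi).
Local Notation U2 := (chart_cod chi').
Local Notation C := (local_cost c chi chi').
Local Notation L := (local_divergence c phi f chi).

Definition local_map : E -> E := coords chi' \o f \o param chi.
Local Notation F := local_map.

(** The intersection with [[set: M]] keeps this literally the domain that [smooth_map_on] gives for
    [f]. *)
Definition local_dom : set E :=
  U1 `&` param chi @^-1` ([set: M] `&` f @^-1` chart_dom chi').
Local Notation O := local_dom.

Let fr := frame_row R n.
Let oU1 : open U1. Proof. exact: cod_open. Qed.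
Let oU2 : open U2. Proof. exact: cod_open. Qed.

Lemma open_local_dom : open O.
Proof.
rewrite /local_dom setTI.
apply: (@open_preimage_on _ _ U1 (f \o param chi)) => //; last exact: dom_open.
move=> x Ux; apply: continuous_comp; first exact: param_continuous.
by have [[+ _] _] := f_diffeo; exact.
Qed.
Let oO := open_local_dom.

Lemma local_dom_sub x : O x -> U1 x.
Proof. by case. Qed.

Lemma local_map_cod x : O x -> U2 (F x).
Proof. by case=> Ux [_ fx]; exact: coord_cod. Qed.

Lemma param_local_map x : O x -> param chi' (F x) = f (param chi x).
Proof. by case=> Ux [_ fx]; exact: coordK. Qed.

Lemma local_dom_coords p : chart_dom chi p -> chart_dom chi' (f p) -> O (coords chi p).
Proof.
move=> dp dfp; split; first exact: coord_cod.
by split=> //; rewrite /preimage /= coordK.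
Qed.

Lemma local_map_coords p : chart_dom chi p -> F (coords chi p) = coords chi' (f p).
Proof. by move=> dp; rewrite /local_map /= coordK. Qed.

Lemma smooth_local_map : smooth_on O F.
Proof. by have [[_ +] _] := f_diffeo; exact. Qed.
Let sF := smooth_local_map.

Let sC : smooth_on (U1 `*` U2) C. Proof. exact: c_smooth. Qed.

Let ph := phi \o param chi.
Let sph : smooth_on O ph.
Proof. by apply: smooth_sub local_dom_sub _; exact: phi_smooth. Qed.

(** The [c]-transform at the image point, written so that its smoothness follows from that of the
    cost, [f] and [phi]. *)
Let kappa x := C (x, F x) - ph x.
Let skappa : smooth_on O kappa.
Proof.
apply: smooth_add => //; last exact: smooth_opp.
apply: (smooth_comp (frame_prod fr fr) (U' := U1 `*` U2)) => //.
- exact: open_setM.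
- by move=> x Ox; split; [exact: local_dom_sub|exact: local_map_cod].
- by apply: smooth_pair => //; exact: smooth_id.
Qed.

Let LE x y : O x -> O y -> L (x, y) = C (x, F y) - ph x - kappa y.
Proof.
move=> Ox Oy; rewrite /local_divergence c_divergence_graph//.
by rewrite /kappa /local_cost /= !param_local_map.
Qed.

Let L_ge0 x y : O y -> 0 <= L (x, y).
Proof. by move=> Oy; exact: c_divergence_ge0. Qed.

Let L_diag x : O x -> L (x, x) = 0.
Proof. by move=> Ox; rewrite /local_divergence c_divergence_graph// subrr. Qed.

Lemma smooth_local_divergence : smooth_on (O `*` O) L.
Proof.
exact: (smooth_divergence fr fr oO oU1 oU2 local_dom_sub local_map_cod sC sF sph skappa LE).
Qed.
Let sL := smooth_local_divergence.

(** The inverse [g] is controlled only on the range of [f], so the neighbourhood keeps the points of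
    the range whose preimage lies in the chart [chi]. *)
Lemma local_inverse x : O x ->
  exists G : E -> E, exists2 O' : set E, open O' /\ O' (F x) &
    smooth_on O' G /\ G (F x) = x /\ forall y, O' y -> O (G y) /\ F (G y) = y.
Proof.
move=> Ox; have [[fc _] [orange [g gK [gc gs]]]] := f_diffeo.
exists (coords chi \o g \o param chi').
exists (U2 `&` param chi' @^-1` (range f `&` g @^-1` chart_dom chi)); last split.
- split; first apply: open_preimage_on => //.
  + by move=> y Uy; exact: param_continuous.
  + by apply: open_preimage_on => //; exact: dom_open.
  + split; first exact: local_map_cod.
    rewrite /preimage /= param_local_map//; split; first by exists (param chi x).
    by rewrite gK; apply: param_dom; exact: local_dom_sub.
- exact: gs.
- split; first by rewrite /= param_local_map// gK paramK//; exact: local_dom_sub.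
  move=> y [Uy []]; rewrite /preimage /= => -[p _ fp]; rewrite -fp gK => dp.
  split.
    apply: local_dom_coords => //; rewrite fp; exact: param_dom.
  by rewrite /local_map /= coordK// fp paramK.
Qed.

Lemma pd_local_map_surj x : O x -> forall b, exists w, pd w F x = b.
Proof.
move=> Ox b; have [G [D [oD DF] [sG [GF FG]]]] := local_inverse Ox.
exists (pd b G (F x)).
have OGF : O (G (F x)) by rewrite GF.
have := pd_smooth_comp fr b oO sG sF DF OGF; rewrite GF => <-.
rewrite (@pd_ext _ _ _ D _ id)//; last by move=> y /FG[].
by apply: pd_val; exact: is_derive_id.
Qed.

(** By [divergence_pd12], [g] is minus the cost matrix times the transposed Jacobian [Jm] of [F].
    The first is invertible by nondegeneracy, the second because [f] has a smooth inverse. *)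
Lemma metric_g_unit x : O x -> metric_g c phi f chi x \in unitmx.
Proof.
move=> Ox.
pose Jm : 'M[R]_n := \matrix_(l, j) pd (delta_mx 0 l) F x 0 j.
have Jlin w : pd w F x = w *m Jm.
  rewrite [in LHS](row_sum_delta w) pd_sumZ; last first.
    exact: (Ck_differentiable fr oO (sF 1%N)).
  apply/rowP => j; rewrite summxE mxE; apply: eq_bigr => l _.
  by rewrite !mxE.
have uJ : Jm \in unitmx.
  have /choice[w wE] := pd_local_map_surj Ox.
  (* Row [i] of [W] is sent by the differential of [F] to the [i]-th basis row, so [W] is a left
     inverse of the square matrix [Jm]. *)
  pose W : 'M[R]_n := \matrix_i w (delta_mx 0 i).
  have : W *m Jm = 1%:M.
    apply/row_matrixP => i; rewrite row_mul rowK -Jlin wE.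
    by rewrite rowE mulmx1.
  by move=> /mulmx1_unit[].
have Uz : (U1 `*` U2) (x, F x) by split; [exact: local_dom_sub|exact: local_map_cod].
have -> : metric_g c phi f chi x = - (cost_mx c chi chi' (x, F x) *m Jm^T).
  apply/matrixP => k l; rewrite !mxE; congr (- _).
  rewrite partial1E partial2E.
  rewrite (divergence_pd12 fr fr oO oU1 oU2 local_dom_sub local_map_cod sC sF skappa LE)//.
  rewrite (pd12_expand _ sC)//; last exact: open_setM.
  rewrite (bigD1 k)//= [X in _ + X]big1 ?addr0 => [|i ik]; last first.
    by apply: big1 => j _; rewrite !mxE (negbTE ik) !mul0r.
  by apply: eq_bigr => j _; rewrite !mxE !eqxx mul1r mulrC.
by rewrite -scaleN1r unitmxZ ?unitrN1// unitmx_mul unitmx_tr uJ c_nondegenerate.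
Qed.

(** A direction [w] in the second slot of the divergence becomes [pd w F x] for the cost; as the
    differential of [F] is onto, every [b] is reached. *)
Lemma primal_cost x (a a2 : E) : O x ->
  (forall k, a2 0 k + \sum_i \sum_j christoffel c phi f chi x i j k * a 0 i * a 0 j = 0) ->
  forall b, pd (a2, 0) (pd (0, b) C) (x, F x) +
            pd (a, 0) (pd (a, 0) (pd (0, b) C)) (x, F x) = 0.
Proof.
move=> Ox geo b; have [w <-] := pd_local_map_surj Ox b.
have := primal_contract oO sL Ox w (metric_g_unit Ox) geo.
rewrite (divergence_pd12 fr fr oO oU1 oU2 local_dom_sub local_map_cod sC sF skappa LE)//.
by rewrite (divergence_pd112 fr fr oO oU1 oU2 local_dom_sub local_map_cod sC sF skappa LE).
Qed.

Lemma dual_cost (J : set R) (S : R -> E) t :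
  open J -> J t -> (forall r, J r -> O (S r)) -> smooth_on J S ->
  let s1 := pd (1 : R) S t in let s2 := pd (1 : R) (pd (1 : R) S) t in
  let Q := fun r => F (S r) in
  let b := pd (1 : R) Q t in let q := pd (1 : R) (pd (1 : R) Q) t in
  let z := (S t, F (S t)) in
  (forall k, s2 0 k + \sum_i \sum_j
     christoffel_star c phi f chi (S t) i j k * s1 0 i * s1 0 j = 0) ->
  forall w, pd (w, 0) (pd (0, b) (pd (0, b) C)) z + pd (w, 0) (pd (0, q) C) z = 0.
Proof.
move=> oJ Jt SO sS s1 s2 Q b q z geo w.
have Ox := SO t Jt.
apply: (divergence_dual fr fr oO oU1 oU2 local_dom_sub local_map_cod sC sF sph LE oJ Jt SO sS).
apply: (dual_contract oO sL Ox _ w (metric_g_unit Ox) geo).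
by move=> u v; apply: (divergence_sym fr fr oO oU1 oU2 local_dom_sub local_map_cod sC sF sph skappa LE).
Qed.

End LocalTransport.

(** * Comparison of the fourth derivative with the curvature *)

Theorem theorem5 (R : realType) (n : nat) (n_ge2 : (2 <= n)%N)
    (M M' : manifold R n)
    (c : M -> M' -> R) (c_smooth : smooth_cost c)
    (c_nondegenerate : nondegenerate_cost c)
    (phi : M -> R) (phi_smooth : smooth_fun phi)
    (phi_concave : c_concave c phi)
    (f : M -> M') (f_c_gradient : is_c_gradient c phi f)
    (f_diffeo : diffeo_onto_range f)
    (x : M * M') (I J : set R)
    (I_open : open I) (I_interval : is_interval I) (I0 : I 0)
    (J_open : open J) (J_interval : is_interval J) (J0 : J 0)
    (gamma : R -> M * M') (gamma_geodesic : primal_geodesic c phi f I gamma)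
    (sigma : R -> M * M') (sigma_geodesic : dual_geodesic c phi f J sigma)
    (gamma0 : gamma 0 = x) (sigma0 : sigma 0 = x)
    (p : R -> M) (p_def : p = (fun s => (gamma s).1))
    (q' : R -> M') (q'_def : q' = (fun t => (sigma t).2))
    (chi : chart R n M) (chi_atlas : atlas chi) (chi_x : chart_dom chi x.1)
    (chi' : chart R n M') (chi'_atlas : atlas chi') (chi'_x : chart_dom chi' x.2)
    (nabla : ('rV[R]_n * 'rV[R]_n -> 'rV[R]_n * 'rV[R]_n) ->
             ('rV[R]_n * 'rV[R]_n -> 'rV[R]_n * 'rV[R]_n) ->
             'rV[R]_n * 'rV[R]_n -> 'rV[R]_n * 'rV[R]_n)
    (nabla_levi_civita :
       is_levi_civita (chart_cod chi `*` chart_cod chi') (metric_h c chi chi') nabla)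
    (X Y : 'rV[R]_n * 'rV[R]_n -> 'rV[R]_n * 'rV[R]_n)
    (X_smooth : smooth_on (chart_cod chi `*` chart_cod chi') X)
    (Y_smooth : smooth_on (chart_cod chi `*` chart_cod chi') Y)
    (X_x : X (coords chi x.1, coords chi' x.2) = (derive1 (coords chi \o p) 0, 0))
    (Y_x : Y (coords chi x.1, coords chi' x.2) = (0, derive1 (coords chi' \o q') 0)) :
  derive1n 2 (fun s =>
    derive1n 2 (fun t => c_divergence c phi (gamma s) (sigma t)) 0) 0 =
  derive1n 2 (fun s => derive1n 2 (fun t => c (p s) (q' t)) 0) 0 /\
  derive1n 2 (fun s => derive1n 2 (fun t => c (p s) (q' t)) 0) 0 =
  - 2 * sec_u (metric_h c chi chi') nabla X Y (coords chi x.1, coords chi' x.2).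
Proof.
subst p q'.
have [gG [gc gs] gGeo] := gamma_geodesic.
have [sG [sc ss] sGeo] := sigma_geodesic.
have fcont : forall y, {for y, continuous f} by have [[+ _] _] := f_diffeo => + y; exact.
pose p s := (gamma s).1; pose r t := (sigma t).1.
have gE s : I s -> gamma s = (p s, f (p s)).
  by move=> /gG [y _ yE]; rewrite /p -yE.
have sE t : J t -> sigma t = (r t, f (r t)).
  by move=> /sG [y _ yE]; rewrite /r -yE.
have px : p 0 = x.1 by rewrite /p gamma0.
have rx : r 0 = x.1 by rewrite /r sigma0.
have xE : x = (x.1, f x.1) by rewrite -gamma0 gE.
have fx : f x.1 = x.2 by rewrite [in RHS]xE.
have chi'_fx : chart_dom chi' (f x.1) by rewrite fx.
(* Coordinates are meaningful only while the curves stay in the charts, so [I] and [J] are cut down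
   to open neighbourhoods of [0], which leaves derivatives at [0] unchanged. *)
pose D' := chart_dom chi `&` f @^-1` chart_dom chi'.
have oD' : open D'.
  by apply: open_preimage_on => //; exact: dom_open.
pose I' := I `&` p @^-1` chart_dom chi.
have oI' : open I' by apply: open_preimage_on => //; exact: dom_open.
have I'0 : I' 0 by split=> //; rewrite /preimage /= px.
pose J' := J `&` r @^-1` D'.
have oJ' : open J' by exact: open_preimage_on.
have J'0 : J' 0 by split=> //; rewrite /preimage /= rx.
pose P : R -> 'rV[R]_n := coords chi \o p.
pose S : R -> 'rV[R]_n := coords chi \o r.
pose Q : R -> 'rV[R]_n := coords chi' \o (fun t => (sigma t).2).
pose F := local_map f chi chi'; pose O := local_dom f chi chi'.
have oO : open O by exact: open_local_dom.
have sP : smooth_on I' P by exact: gs.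
have sS : smooth_on J' S by apply: smooth_sub (ss chi chi_atlas) => t [Jt []].
have SO t : J' t -> O (S t) by move=> [_ []]; exact: local_dom_coords.
have QE t : J' t -> F (S t) = Q t.
  by move=> [Jt [rt _]]; rewrite /Q /= sE//= /F /S /= local_map_coords.
have sF : smooth_on O F by exact: smooth_local_map.
have sFS : smooth_on J' (fun t => F (S t)).
  exact: (smooth_comp (frame_row R n) oJ' oO SO sS sF).
(* A geodesic of the graph has a smooth first component by definition; smoothness of the second
   comes from [F]. *)
have sQ : smooth_on J' Q by exact: smooth_ext oJ' QE sFS.
pose C := local_cost c chi chi'.
have sC : smooth_on (chart_cod chi `*` chart_cod chi') C by exact: c_smooth.
have oU : open (chart_cod chi `*` chart_cod chi') by exact: open_chart_cod2.
have oU1 : open (chart_cod chi) := @cod_open _ _ _ chi.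
have oU2 : open (chart_cod chi') := @cod_open _ _ _ chi'.
have PU s : I' s -> chart_cod chi (P s) by case=> _; exact: coord_cod.
have QU t : J' t -> chart_cod chi' (Q t).
  by move=> Jt; rewrite -QE//; apply: local_map_cod; exact: SO.
have SU t : J' t -> chart_cod chi (S t) by move=> Jt; apply: local_dom_sub (SO _ Jt).
have cE s t : I' s -> J' t -> c (p s) (sigma t).2 = C (P s, Q t).
  move=> [Is ps] [Jt [_ rt]]; rewrite /C /local_cost /P /Q /= !coordK//.
  by rewrite sE.
have inner s : I' s -> pd (1 : R) (pd (1 : R) (fun t => c (p s) (sigma t).2)) 0 = pd (1 : R) (pd (1 : R) (fun t => C (P s, Q t))) 0.
  by move=> Is; apply: (pd_pd_ext _ _ oJ') => // t; exact: cE.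
have derivE (G : R -> R -> R) :
    derive1n 2 (fun s => derive1n 2 (fun t => G s t) 0) 0 =
    pd (1 : R) (pd (1 : R) (fun s => pd (1 : R) (pd (1 : R) (G s)) 0)) 0.
  by rewrite derive1n2E; congr (pd _ (pd _ _) _); apply/funext => s; rewrite derive1n2E.
split.
  rewrite !derivE.
  (* The value of the [c]-transform along [sigma]. The divergence is the cost minus [phi (p s)] and
     [k t]: the [t]-derivatives remove the former, and the second derivative of [k] at [0] is a
     constant that the [s]-derivatives remove. *)
  pose k t := C (S t, Q t) - phi (param chi (S t)).
  have sk : smooth_on J' k.
    apply: smooth_add => //.
      apply: (smooth_comp (frame_prod (frame_row R n) (frame_row R n)) oJ' oU _ _ sC).
        by move=> t Jt; split; [exact: SU|exact: QU].
      exact: smooth_pair.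
    apply: smooth_opp => //.
    exact: (smooth_comp (frame_row R n) oJ' oU1 SU sS (phi_smooth _ chi_atlas)).
  have divE s t : I' s -> J' t -> c_divergence c phi (gamma s) (sigma t) =
      C (P s, Q t) - phi (p s) - k t.
    move=> Is Jt; have [I_s _] := Is; have [J_t [rt rt']] := Jt.
    rewrite gE// sE// c_divergence_graph// -cE// sE//=; congr (_ - _).
    by rewrite /k /C /local_cost /Q /S /= sE//= !coordK.
  have inner' s : I' s -> pd (1 : R) (pd (1 : R) (fun t => c_divergence c phi (gamma s) (sigma t))) 0 =
      pd (1 : R) (pd (1 : R) (fun t => c (p s) (sigma t).2)) 0 - pd (1 : R) (pd (1 : R) k) 0.
    move=> Is; rewrite inner//.
    have sl : smooth_on J' (fun t => C (P s, Q t)).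
      apply: (smooth_comp (frame_prod (frame_row R n) (frame_row R n)) oJ' oU _ _ sC).
        by move=> t Jt; split; [exact: PU|exact: QU].
      by apply: smooth_pair => //; exact: smooth_cst.
    have sl' : smooth_on J' (fun t => C (P s, Q t) - phi (p s)).
      by apply: smooth_add => //; exact: smooth_cst.
    rewrite [LHS](pd_pd_ext _ _ oJ' (fun t => divE s t Is) J'0).
    rewrite (@pd_ext _ _ _ J' _ (fun t => pd (1 : R) (fun t => C (P s, Q t)) t - pd (1 : R) k t))//; last first.
      by move=> t Jt; rewrite (pdB (U := J'))// pd_sub_cst.
    by rewrite (pdB (U := J'))//; exact: smooth_pd.
  rewrite [LHS](pd_pd_ext _ _ oI' inner' I'0).
  by congr (pd _ _ _); apply/funext => s; exact: pd_sub_cst.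
rewrite derivE [LHS](pd_pd_ext _ _ oI' inner I'0).
pose fr := frame_row R n.
rewrite [LHS](mixed_fourth_derivative fr fr oU1 oU2 sC oI' oJ' sP sQ PU QU I'0 J'0).
set a := pd _ P 0; set a2 := pd _ (pd _ P) 0; set b := pd _ Q 0; set q := pd _ (pd _ Q) 0.
set z := (P 0, Q 0).
have P0 : P 0 = coords chi x.1 by rewrite /P /= px.
have S0 : S 0 = coords chi x.1 by rewrite /S /= rx.
have Q0 : Q 0 = coords chi' x.2 by rewrite /Q /= sigma0.
have Ox : O (P 0) by rewrite P0 -S0; exact: SO.
have Fx : F (P 0) = Q 0 by rewrite P0 -S0 QE.
have Uz : (chart_cod chi `*` chart_cod chi') z by split; [exact: PU|exact: QU].
have primal : forall w, pd (a2, 0) (pd (0, w) C) z + pd (a, 0) (pd (a, 0) (pd (0, w) C)) z = 0.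
  rewrite /z -Fx; apply: (primal_cost c_smooth c_nondegenerate phi_smooth f_c_gradient f_diffeo chi_atlas chi'_atlas Ox).
  move=> k; have := gGeo chi chi_atlas 0 I0; rewrite gamma0 => /(_ chi_x k).
  rewrite derive1n2E (pd_pd_row_coord oI' sP k I'0) -/a2 P0 => geo.
  rewrite -[RHS]geo; congr (_ + _); apply: eq_bigr => i _; apply: eq_bigr => j _.
  by rewrite !derive1E !pdxE !(pd_row_coord sP _ I'0).
have dual : forall w, pd (w, 0) (pd (0, b) (pd (0, b) C)) z + pd (w, 0) (pd (0, q) C) z = 0.
  have := dual_cost c_smooth c_nondegenerate phi_smooth f_c_gradient f_diffeo chi_atlas chi'_atlas
    oJ' J'0 SO sS.
  have QE1 t : J' t -> pd (1 : R) (fun t => F (S t)) t = pd (1 : R) Q t.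
    by move=> Jt; apply: (pd_ext _ oJ').
  rewrite /= -/F QE1// (pd_pd_ext _ _ oJ' QE J'0) QE// -/b -/q.
  rewrite S0 -P0 -/z; apply=> k.
  have := sGeo chi chi_atlas 0 J0; rewrite sigma0 => /(_ chi_x k).
  rewrite derive1n2E (pd_pd_row_coord oJ' sS k J'0) P0 => geo.
  rewrite -[RHS]geo; congr (_ + _); apply: eq_bigr => i _; apply: eq_bigr => j _.
  by rewrite !derive1E !pdxE !(pd_row_coord sS _ J'0).
have dz : (coords chi x.1, coords chi' x.2) = z by rewrite /z P0 Q0.
have Xz : X z = (a, 0) by rewrite -dz X_x derive1E pdxE.
have Yz : Y z = (0, b) by rewrite -dz Y_x derive1E pdxE.
rewrite dz.
rewrite (sec_u_cost fr fr oU sC (metric_hE sC) nabla_levi_civita X_smooth Y_smooth Uz Xz Yz dual).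
rewrite (smooth_reverse (0, q) (a, 0) (a, 0) oU sC Uz).
(* Taken in the direction [a2], the dual equation cancels the two terms that contain the
   acceleration of [P]. *)
have /eqP := dual a2; rewrite addr_eq0 => /eqP ->.
have /eqP := primal q; rewrite addr_eq0 => /eqP ->.
by ring.
Qed.
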